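(* $\mathrm{Fin}(10)=\mathrm{Adm}(10)\setminus\{(1,8),(3,1),(3,5),(4,1),(4,3),(5,1),(5,2)\}$.
   Context: $K_4-e$ is the graph on four vertices $a,b,c,d$ with edges $ab,ac,ad,bc,bd$; it is denoted $[a,b,c-d]$. A $(K_4-e)$-design of order $v$ is a pair $(X,\mathcal B)$ where $X$ is a set of $v$ vertices and $\mathcal B$ is a collection of copies of $K_4-e$ (blocks) with vertices in $X$ whose edge sets partition the edges of $K_v$ on $X$; it has $b_v=v(v-1)/10$ blocks. For a graph $B$, $T(B)$ is the set of its triangles (3-vertex subsets inducing a triangle); e.g. $T([a,b,c-d])=\{\{a,b,c\},\{a,b,d\}\}$, and $T(\mathcal B)=\bigcup_{B\in\mathcal B}T(B)$. Two designs $(X,\mathcal B_1),(X,\mathcal B_2)$ on the same vertex set intersect in $s$ blocks if $|\mathcal B_1\cap\mathcal B_2|=s$, and in $t$ triangles if $|T(\mathcal B_1)\cap T(\mathcal B_2)|=t$. Define $\mathrm{Fin}(v)=\{(s,t):$ there exists a pair of $(K_4-e)$-designs of order $v$ on the same vertex set intersecting in $s$ blocks and $t+2s$ triangles$\}$; $J(v)=\{s:$ there is a pair of $(K_4-e)$-designs of order $v$ intersecting in $s$ blocks$\}$; $J_T(v)=\{t:$ there is a pair of $(K_4-e)$-designs of order $v$ intersecting in $t$ triangles$\}$; and $\mathrm{Adm}(v)=\{(s,t): s,t\ge 0,\ s+t\le b_v,\ s\in J(v),\ t+2s\in J_T(v)\}$. (Known from the literature: $J(10)=\{0,1,\dots,6,9\}$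 and $J_T(10)=\{0,1,\dots,12,14,15,18\}$.) *)

(* Defs.v *)
From mathcomp Require Import all_boot.
Set Implicit Arguments. Unset Strict Implicit. Unset Printing Implicit Defensive.

(* Vertex set of order v is taken to be 'I_v.  A graph on 'I_v is
   represented by its edge set : {set {set 'I_v}} (edges are 2-subsets). *)

Definition k4e_graph (v : nat) (a b c d : 'I_v) : {set {set 'I_v}} :=
  [set [set a; b]; [set a; c]; [set a; d]; [set b; c]; [set b; d]].

Definition is_k4e (v : nat) (B : {set {set 'I_v}}) : Prop :=
  exists a b c d : 'I_v,
    [/\ uniq [:: a; b; c; d] & B = k4e_graph a b c d].

Definition is_design (v : nat) (Bs : {set {set {set 'I_v}}}) : Prop :=
  (forall B, B \in Bs -> is_k4e B) /\
  (forall x y : 'I_v, x != y ->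
     #|[set B in Bs | [set x; y] \in B]| = 1).

(* Number of blocks b_v = v(v-1)/10. *)
Definition bv (v : nat) : nat := v * (v - 1) %/ 10.

Definition triangles (v : nat) (B : {set {set 'I_v}}) : {set {set 'I_v}} :=
  [set t : {set 'I_v} | (#|t| == 3) &&
     [forall x in t, forall y in t, (x != y) ==> ([set x; y] \in B)]].

Definition trianglesD (v : nat) (Bs : {set {set {set 'I_v}}}) : {set {set 'I_v}} :=
  \bigcup_(B in Bs) triangles B.

Definition Fin (v s t : nat) : Prop :=
  exists B1 B2 : {set {set {set 'I_v}}},
    [/\ is_design B1, is_design B2, #|B1 :&: B2| = s &
        #|trianglesD B1 :&: trianglesD B2| = t + 2 * s].

Definition J (v s : nat) : Prop :=
  exists B1 B2 : {set {set {set 'I_v}}},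
    [/\ is_design B1, is_design B2 & #|B1 :&: B2| = s].

Definition JT (v t : nat) : Prop :=
  exists B1 B2 : {set {set {set 'I_v}}},
    [/\ is_design B1, is_design B2 &
        #|trianglesD B1 :&: trianglesD B2| = t].

Definition Adm (v s t : nat) : Prop :=
  [/\ s + t <= bv v, J v s & JT v (t + 2 * s)].

(* Main.v *)
Require Import Defs.
From mathcomp Require Import all_boot zify.
Set Implicit Arguments. Unset Strict Implicit. Unset Printing Implicit Defensive.

(* A point of a design of order 10 has degree 9, split into parts 2 and 3 by the
   blocks through it, so it has degree 3 in three blocks (a hub) or in exactly
   one; counting gives four hubs.  Any two hubs span the central edge of a block, and
   these six blocks attach to the three perfect matchings of the hubs the three
   pairs of a partition N of the six other points.  The three remaining blocks
   live on the non-hubs and are [p, q - r], with p, q, r running cyclically over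
   the pairs of a partition.  Up to relabelling, this leaves three designs.

   A block is shared by two designs iff both of its triangles are, as both
   contain the central edge.  Hence the numbers of common blocks and triangles
   are sums over the blocks of the second design, and, once its hubs are fixed,
   the contributions of N and of the cyclic part vary independently: the 40
   possible values come out of a short enumeration. *)

(** * Edges and triangles of a single block *)

Lemma eq_set2 (T : finType) (a b c d : T) :
  ([set a; b] == [set c; d]) = (a == c) && (b == d) || (a == d) && (b == c).
Proof.
apply/eqP/idP => [E|/orP[] /andP[/eqP-> /eqP->] //]; last by rewrite setUC.
have /[!inE] Ha : a \in [set c; d] by rewrite -E !inE eqxx.
have /[!inE] Hb : b \in [set c; d] by rewrite -E !inE eqxx orbT.
have /[!inE] Hc : c \in [set a; b] by rewrite E !inE eqxx.
have /[!inE] Hd : d \in [set a; b] by rewrite E !inE eqxx orbT.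
move: Ha Hb Hc Hd; rewrite !(eq_sym c) !(eq_sym d).
by do 4!case: (_ == _).
Qed.

(** Both orientations of each inequality are packed into one rewriting rule, so that any comparison
    of two block vertices reduces to [false]. *)
Lemma uniq4_neq (T : eqType) (a b c d : T) : uniq [:: a; b; c; d] ->
  (((a == b) = false) * ((a == c) = false) * ((a == d) = false) *
   ((b == c) = false) * ((b == d) = false) * ((c == d) = false)) *
  (((b == a) = false) * ((c == a) = false) * ((d == a) = false) *
   ((c == b) = false) * ((d == b) = false) * ((d == c) = false)).
Proof.
rewrite /= !inE !negb_or => /and4P[/and3P[/negPf ab /negPf ac /negPf ad]].
by move=> /andP[/negPf bc /negPf bd] /negPf cd _; do !split; rewrite // eq_sym.
Qed.

Lemma seq4P (T : eqType) (a b c d z : T) : [\/ z = a, z = b, z = c | z = d] \/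
  ((z == a) = false) * ((z == b) = false) * ((z == c) = false) * ((z == d) = false).
Proof.
have [->|_] := eqVneq z a; first by left; constructor 1.
have [->|_] := eqVneq z b; first by left; constructor 2.
have [->|_] := eqVneq z c; first by left; constructor 3.
by have [->|_] := eqVneq z d; [left; constructor 4 | right].
Qed.

Section Blocks.

Variable v : nat.
Implicit Types (a b c d x y z : 'I_v).

Lemma k4eCl a b c d : k4e_graph a b c d = k4e_graph b a c d.
Proof.
apply/setP => e; rewrite !inE (setUC [set b] [set a]).
by case: (e == [set a; b]); case: (e == [set a; c]); case: (e == [set a; d]);
  rewrite /= ?orbT ?orbF.
Qed.

Lemma k4eCr a b c d : k4e_graph a b c d = k4e_graph a b d c.
Proof.
apply/setP => e; rewrite !inE.
by case: (e == [set a; c]); case: (e == [set a; d]); case: (e == [set b; c]);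
  rewrite /= ?orbT ?orbF.
Qed.

(** The only pair missing from the block is [c], [d], so two distinct vertices of it are adjacent as
    soon as one of them is central. *)
Lemma mem_k4e a b c d x y : uniq [:: a; b; c; d] ->
  ([set x; y] \in k4e_graph a b c d) =
  (x != y) && [&& x \in [:: a; b; c; d], y \in [:: a; b; c; d] &
                  (x \in [:: a; b]) || (y \in [:: a; b])].
Proof.
move=> /uniq4_neq ne; rewrite !inE !eq_set2.
case: (seq4P a b c d x) => [] nx; last by rewrite !nx andbF.
case: (seq4P a b c d y) => [] ny; last by rewrite !ny !andbF.
by case: nx => ->; case: ny => ->; rewrite ?eqxx ?ne.
Qed.

Lemma card_k4e a b c d : uniq [:: a; b; c; d] -> #|k4e_graph a b c d| = 5.
Proof.
move=> /uniq4_neq ne; rewrite /k4e_graph -!setUA !cardsU1 cards1 !inE !eq_set2.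
by rewrite !ne ?andbF.
Qed.

(** Since [c] and [d] are not adjacent, a triangle omits one of them and is then forced to be the
    central edge with the other one. *)
Lemma triangles_k4e a b c d : uniq [:: a; b; c; d] ->
  triangles (k4e_graph a b c d) = [set [set a; b; c]; [set a; b; d]].
Proof.
move=> U; have ne := uniq4_neq U.
apply/setP => t; rewrite !inE; apply/andP/orP => [[/eqP t3 /forall_inP tB]|].
  have edge x y : x \in t -> y \in t -> x != y -> [set x; y] \in k4e_graph a b c d.
    by move=> xt yt nxy; have /forall_inP/(_ y yt)/implyP := tB x xt; apply.
  have sub x : x \in t -> x \in [:: a; b; c; d].
    (* A second point of [t] is taken so that [x] lies on an edge; only edges are known to stay
       inside the block. *)
    move=> xt; have /set0Pn[y /setD1P[nyx yt]] : t :\ x != set0.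
      by rewrite -card_gt0; move: (cardsD1 x t); rewrite xt t3; case: #|_|.
    have := edge x y xt yt; rewrite eq_sym => /(_ nyx).
    by rewrite mem_k4e // => /and4P[].
  have ncd : ~~ ((c \in t) && (d \in t)).
    apply/negP => /andP[ct dt]; have := edge c d ct dt (negbT ne.1.2).
    by rewrite mem_k4e // !inE !ne !andbF.
  have eq3 z : uniq [:: a; b; z] -> t \subset [set a; b; z] -> t = [set a; b; z].
    move=> Uz st; apply/eqP; rewrite eqEcard st t3 -setUA !cardsU1 cards1.
    by move: Uz; rewrite /= !inE => /and3P[-> ->].
  case/nandP: ncd => nt; [right | left]; apply/eqP/eq3; rewrite /= ?inE ?ne //;
    apply/subsetP => x xt; have := sub x xt; rewrite !inE;
    have [E|_] := eqVneq x c; have [F|_] := eqVneq x d; move: nt; rewrite -?E -?F ?xt //;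
    by rewrite ?orbF ?orbT //= orbA.
have main z : uniq [:: a; b; z] -> z \in [:: c; d] -> t = [set a; b; z] ->
    #|t| == 3 /\ [forall (x | x \in t), forall (y | y \in t), (x != y) ==> ([set x;
      y] \in k4e_graph a b c d)].
  move=> Uz zcd ->; split.
    by rewrite -setUA !cardsU1 cards1; move: Uz; rewrite /= !inE => /and3P[-> ->].
  apply/forall_inP => x xt; apply/forall_inP => y yt.
  apply/implyP => nxy; rewrite mem_k4e // nxy /=; move: xt yt; rewrite !inE => xt yt.
  case/orP: xt => [/orP[]|] /eqP Ex; case/orP: yt => [/orP[]|] /eqP Ey; move: zcd nxy;
    rewrite Ex Ey !inE ?eqxx ?orbT ?andbT //=.
  - by case/orP => /eqP->; rewrite ?eqxx ?orbT.
  - by case/orP => /eqP->; rewrite ?eqxx ?orbT.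
  - by case/orP => /eqP->; rewrite ?eqxx ?orbT.
  - by case/orP => /eqP->; rewrite ?eqxx ?orbT.
case=> /eqP; apply: main; rewrite /= ?inE ?ne ?eqxx ?orbT //.
Qed.
End Blocks.

(** * Common blocks and common triangles of two designs *)

Section Designs.

Variable v : nat.
Implicit Types (a b c d x y z : 'I_v) (B C : {set {set 'I_v}}).
Implicit Types Bs : {set {set {set 'I_v}}}.

Lemma design_block_uniq Bs B C x y : is_design Bs -> B \in Bs -> C \in Bs ->
  x != y -> [set x; y] \in B -> [set x; y] \in C -> B = C.
Proof.
move=> [_ D] BBs CBs nxy xyB xyC; have /eqP/cards1P[E EE] := D x y nxy.
have /set1P-> : B \in [set E] by rewrite -EE inE BBs.
by have /set1P-> : C \in [set E] by rewrite -EE inE CBs.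
Qed.

Lemma design_block_ex Bs x y : is_design Bs -> x != y ->
  exists2 B, B \in Bs & [set x; y] \in B.
Proof.
move=> [_ D] nxy; have /eqP/cards1P[E EE] := D x y nxy.
have : E \in [set E] by rewrite inE.
by rewrite -EE inE => /andP[? ?]; exists E.
Qed.

Lemma triangle_edges B (t : {set 'I_v}) x y :
  t \in triangles B -> x \in t -> y \in t -> x != y -> [set x; y] \in B.
Proof.
rewrite inE => /andP[_ /forall_inP tB] xt yt nxy.
by have /forall_inP/(_ y yt)/implyP := tB x xt; apply.
Qed.

(* Both triangles of a block contain its central edge, so in any design they
   come from a single block. *)
Lemma design_common_block Bs1 Bs2 B : is_design Bs1 -> is_design Bs2 ->
  B \in Bs2 -> (B \in Bs1) = (triangles B \subset trianglesD Bs1).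
Proof.
move=> D1 D2 BBs2; apply/idP/idP => [BBs1|].
  by apply/subsetP => t tB; apply/bigcupP; exists B.
have [a [b [c [d [U defB]]]]] := D2.1 B BBs2.
rewrite defB triangles_k4e // => /subsetP sub.
have /bigcupP[C CBs abcC] := sub _ (set21 _ _).
have /bigcupP[C' C'Bs abdC'] := sub _ (set22 _ _).
have ne := uniq4_neq U.
have eqC : C' = C.
  by apply: (design_block_uniq D1 C'Bs CBs (negbT ne.1.1.1.1.1.1));
    [apply: triangle_edges abdC' _ _ _ | apply: triangle_edges abcC _ _ _];
      rewrite ?inE ?eqxx ?orbT ?ne.
rewrite eqC in abdC'; suff -> : k4e_graph a b c d = C by [].
have [a' [b' [c' [d' [U' defC]]]]] := D1.1 C CBs.
(* The two triangles carry all five edges of the block, and [C] has only five edges. *)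
apply/eqP; rewrite eqEcard {2}defC !card_k4e // leqnn andbT.
apply/subsetP => e; rewrite !inE => /orP[/orP[/orP[/orP[]|]|]|] /eqP->;
  solve [apply: triangle_edges abcC _ _ _; rewrite ?inE ?eqxx ?orbT ?ne // |
         apply: triangle_edges abdC' _ _ _; rewrite ?inE ?eqxx ?orbT ?ne //].
Qed.

Lemma card_common_blocks Bs1 Bs2 : is_design Bs1 -> is_design Bs2 ->
  #|Bs1 :&: Bs2| = \sum_(B in Bs2) (triangles B \subset trianglesD Bs1).
Proof.
move=> D1 D2; rewrite -sum1_card (eq_bigl (fun B => (B \in Bs2) && (B \in Bs1))).
  rewrite big_mkcondr; apply: eq_bigr => B BBs2.
  by rewrite (design_common_block D1 D2) //; case: (_ \subset _).
by move=> B; rewrite inE andbC.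
Qed.

(** A triangle contains an edge, so in a design it comes from a single block; hence common triangles
    can be counted block by block without repetition. *)
Lemma card_common_triangles Bs1 Bs2 : is_design Bs2 ->
  #|trianglesD Bs1 :&: trianglesD Bs2| =
  \sum_(B in Bs2) #|triangles B :&: trianglesD Bs1|.
Proof.
move=> D2; rewrite -sum1_card.
transitivity (\sum_(t in trianglesD Bs1) \sum_(B in Bs2) (t \in triangles B)).
  rewrite (eq_bigl (fun t => (t \in trianglesD Bs1) && (t \in trianglesD Bs2))); last first.
    by move=> t; rewrite inE.
  rewrite big_mkcondr; apply: eq_bigr => t _; case: bigcupP => [[B BBs tB]|nt].
    rewrite (bigD1 B) //= tB big1 // => C /andP[CBs nCB].
    apply/eqP; rewrite eqb0; apply: contra nCB => tC; apply/eqP.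
    have /card_gt1P[x [y [xt yt nxy]]] : 1 < #|t|.
      by move: tB; rewrite inE => /andP[/eqP->].
    by apply: (design_block_uniq D2 CBs BBs nxy); [apply: triangle_edges tC _ _ _ | apply:
      triangle_edges tB _ _ _].
  rewrite big1 // => B BBs; apply/eqP; rewrite eqb0; apply/negP => tB.
  by apply: nt; exists B.
rewrite exchange_big; apply: eq_bigr => B _; rewrite -sum1_card.
rewrite [RHS](eq_bigl (fun t => (t \in trianglesD Bs1) && (t \in triangles B))).
  by rewrite [RHS]big_mkcondr; apply: eq_bigr => t _; case: (_ \in triangles _).
by move=> t; rewrite inE andbC.
Qed.

(** These are the contributions of one block to the two sums, in the form that [score]
    accumulates. *)
Lemma k4e_common_triangles Bs (a b c d : 'I_v) : uniq [:: a; b; c; d] ->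
  let x := [set a; b; c] \in trianglesD Bs in
  let y := [set a; b; d] \in trianglesD Bs in
  (triangles (k4e_graph a b c d) \subset trianglesD Bs) = x && y /\
  #|triangles (k4e_graph a b c d) :&: trianglesD Bs| = x + y.
Proof.
move=> U x y; rewrite triangles_k4e //; split.
  by rewrite subUset !sub1set.
rewrite setIUl cardsU.
have set1I (t : {set 'I_v}) : #|[set t] :&: trianglesD Bs| = (t \in trianglesD Bs).
  have [tT|nt] := boolP (t \in _).
    by move: tT; rewrite -sub1set => /setIidPl->; rewrite cards1.
  by apply/eqP; rewrite cards_eq0; apply/eqP/setP => s; rewrite !inE; apply/andP =>
    -[/eqP->]; rewrite (negPf nt).
rewrite !set1I (_ : _ :&: _ = set0) ?cards0 ?subn0 //.
have ne := uniq4_neq U.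
apply/setP => s; rewrite !inE; apply/negP => /andP[/andP[/eqP-> _] /andP[/eqP E _]].
have : c \in [set a; b; d] by rewrite -E !inE eqxx orbT.
by rewrite !inE !ne.
Qed.
End Designs.

Lemma sum_mem_card (T : finType) (A : {set T}) (P : pred T) :
  \sum_(x in A) P x = #|[set x in A | P x]|.
Proof.
rewrite -sum1_card [RHS](eq_bigl (fun x => (x \in A) && P x)); last by move=> x; rewrite inE.
by rewrite [RHS]big_mkcondr.
Qed.

(** * Degrees of the points in a block *)

Section Degree.
Variable v : nat.
Implicit Types (a b c d x y z : 'I_v) (B C : {set {set 'I_v}}).

Definition deg B x : nat := #|[set y | [set x; y] \in B]|.

Lemma deg_k4e a b c d x : uniq [:: a; b; c; d] ->
  deg (k4e_graph a b c d) x = 3 * (x \in [:: a; b]) + 2 * (x \in [:: c; d]).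
Proof.
move=> U; have ne := uniq4_neq U; rewrite /deg.
have -> : [set y | [set x; y] \in k4e_graph a b c d] =
  if x \in [:: a; b] then [set y in [:: a; b; c; d]] :\ x
  else if x \in [:: c; d] then [set a; b] else set0.
  apply/setP => y; rewrite inE mem_k4e // !inE eq_sym.
  have [nx|nx] := seq4P a b c d x; last first.
    by rewrite !nx !andbF /= inE.
  have [ny|ny] := seq4P a b c d y; last first.
    by rewrite !ny !andbF; do !case: ifP; rewrite ?inE ?ny ?andbF.
  by case: nx => ->; case: ny => ->; rewrite ?eqxx ?ne //= ?inE ?eqxx ?ne.
rewrite !inE; case: ifP => [xab|nxab].
  have : #|[set y in [:: a; b; c; d]]| = 4 by rewrite cardsE (card_uniqP U).
  rewrite (cardsD1 x) inE; case/orP: xab => /eqP->; rewrite !inE !eqxx ?orbT !ne => /eqP;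
  by rewrite add1n eqSS => /eqP->.
by case: ifP => // _; rewrite ?cards0 ?cards2 ?ne.
Qed.

Lemma deg_center2 B x y : is_k4e B -> deg B x = 3 -> deg B y = 3 -> x != y ->
  exists z w, uniq [:: x; y; z; w] /\ B = k4e_graph x y z w.
Proof.
move=> [a [b [c [d [U ->]]]]]; have ne := uniq4_neq U; rewrite !deg_k4e //.
move=> dx dy nxy.
have [nx|nx] := seq4P a b c d x; last by rewrite !inE !nx in dx.
have [ny|ny] := seq4P a b c d y; last by rewrite !inE !ny in dy.
have {}nx : x = a \/ x = b.
  by case: nx => Ex; auto; move: dx; rewrite Ex !inE ?eqxx ?ne.
have {}ny : y = a \/ y = b.
  by case: ny => Ey; auto; move: dy; rewrite Ey !inE ?eqxx ?ne.
case: nx => Ex; case: ny => Ey; try by rewrite Ex Ey eqxx in nxy.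
  by exists c, d; rewrite Ex Ey.
exists c, d; rewrite Ex Ey k4eCl; split => //.
by rewrite /= !inE !ne.
Qed.

Lemma deg_center B x : is_k4e B -> deg B x = 3 ->
  exists y z w, uniq [:: x; y; z; w] /\ B = k4e_graph x y z w.
Proof.
move=> kB dx; suff [y nxy dy] : exists2 y, x != y & deg B y = 3.
  by exists y; apply: deg_center2.
have [a [b [c [d [U defB]]]]] := kB; have ne := uniq4_neq U.
exists (if x == a then b else a); last first.
  by case: ifP => _; rewrite defB deg_k4e // !inE ?eqxx ?ne.
by have [->|] := eqVneq x a; rewrite ?ne.
Qed.

Lemma sum_deg_k4e B : is_k4e B -> \sum_x deg B x = 10.
Proof.
move=> [a [b [c [d [U ->]]]]].
under eq_bigr => x _ do rewrite deg_k4e //.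
rewrite big_split /= -!big_distrr /=.
have count2 x y : x != y -> \sum_z (z \in [:: x; y] : nat) = 2.
  move=> nxy; transitivity #|[set x; y]|; last by rewrite cards2 nxy.
  by rewrite -sum1_card [RHS]big_mkcond; apply: eq_bigr => z _; rewrite !inE.
by rewrite !count2 ?(uniq4_neq U).
Qed.

Lemma card_center_k4e B : is_k4e B -> #|[set x | deg B x == 3]| = 2.
Proof.
move=> [a [b [c [d [U ->]]]]]; have ne := uniq4_neq U.
transitivity #|[set a; b]|; last by rewrite cards2 ne.
congr #|pred_of_set _|; apply/setP => x; rewrite !inE deg_k4e // !inE.
by have [nx|nx] := seq4P a b c d x; [case: nx => -> | ]; rewrite ?nx ?eqxx ?ne.
Qed.

Lemma deg_k4e_split B x : is_k4e B -> deg B x = 3 * (deg B x == 3) + 2 * (deg B x == 2).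
Proof.
move=> [a [b [c [d [U ->]]]]]; have ne := uniq4_neq U; rewrite deg_k4e // !inE.
by have [nx|nx] := seq4P a b c d x; [case: nx => -> | ]; rewrite ?nx ?eqxx ?ne.
Qed.

End Degree.

(** * Counting: a design of order 10 has four hubs *)

Section Order10.
Variable Bs : {set {set {set 'I_10}}}.
Hypothesis D : is_design Bs.

Definition ndeg k x := #|[set B in Bs | deg B x == k]|.

Lemma sum_deg_design x : \sum_(B in Bs) deg B x = 9.
Proof.
transitivity (\sum_(y | y != x) 1); last first.
  by rewrite sum1_card (eq_card (B := predC1 x)) // cardC1 card_ord.
transitivity (\sum_(B in Bs) \sum_(y | y != x) ([set x; y] \in B : nat)).
  apply: eq_bigr => B BBs; rewrite /deg -sum1_card big_mkcond [RHS]big_mkcond.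
  apply: eq_bigr => y _; rewrite inE; case: eqVneq => [->|] //=.
  case: D => /(_ B BBs) [a [b [c [d [U ->]]]]] _.
  by rewrite mem_k4e // eqxx.
rewrite exchange_big; apply: eq_bigr => y nyx /=.
by rewrite sum_mem_card; apply: D.2; rewrite eq_sym.
Qed.

Lemma sum_ndeg x k : \sum_(B in Bs) (deg B x == k) = ndeg k x.
Proof. exact: sum_mem_card. Qed.

(** The nine edges at [x] are shared out among the blocks through [x], each of which takes 3 or 2 of
    them. *)
Lemma ndeg_eq x : 3 * ndeg 3 x + 2 * ndeg 2 x = 9.
Proof.
rewrite -(sum_deg_design x) -!sum_ndeg !big_distrr -big_split /=.
by apply: eq_bigr => B BBs; rewrite -deg_k4e_split //; apply: D.1.
Qed.

(** Double counting of degrees: ten points have degree 9 each, and a block has degree sum 10. *)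
Lemma card_design : #|Bs| = 9.
Proof.
have : \sum_(B in Bs) \sum_x deg B x = 90.
  rewrite exchange_big; under eq_bigr => x _ do rewrite sum_deg_design.
  by rewrite sum_nat_const card_ord.
under eq_bigr => B BBs do rewrite (sum_deg_k4e (D.1 B BBs)).
by rewrite sum_nat_const; lia.
Qed.

(** In natural numbers 3p + 2q = 9 has only the solutions (3, 0) and (1, 3); hubs are the points of
    the first kind. *)
Definition hubs := [set x | ndeg 3 x == 3].

Lemma ndeg_hub x : x \in hubs -> ndeg 3 x = 3 /\ ndeg 2 x = 0.
Proof. by rewrite inE => /eqP; have := ndeg_eq x; lia. Qed.

Lemma ndeg_nonhub x : x \notin hubs -> ndeg 3 x = 1 /\ ndeg 2 x = 3.
Proof. by rewrite inE => /eqP; have := ndeg_eq x; lia. Qed.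

(** Nine blocks with two central vertices each give total 18. Every point contributes 1 and a hub 2
    more, so 10 + 2h = 18 for h hubs. *)
Lemma card_hubs : #|hubs| = 4.
Proof.
have : \sum_x ndeg 3 x = 18.
  under eq_bigr => x _ do rewrite -sum_ndeg.
  rewrite exchange_big /=.
  transitivity (\sum_(B in Bs) 2); last by rewrite sum_nat_const card_design.
  apply: eq_bigr => B BBs; apply: etrans (card_center_k4e (D.1 B BBs)); rewrite -sum1_card.
  by rewrite [RHS]big_mkcond; apply: eq_bigr => x _; rewrite inE; case: eqP.
have -> : \sum_x ndeg 3 x = \sum_x (1 + 2 * (x \in hubs)).
  apply: eq_bigr => x _; have [/ndeg_hub[-> _]|/ndeg_nonhub[-> _]] // := boolP (x \in hubs).
rewrite big_split /= -big_distrr sum_nat_const card_ord.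
have -> : \sum_(i in 'I_10) (i \in hubs) = #|hubs|.
  by rewrite -sum1_card [RHS]big_mkcond; apply: eq_bigr => x _; case: (x \in hubs).
by rewrite /=; lia.
Qed.

End Order10.

(** Adjacency in a block is read off the degrees: both points are in the block and one is central.
    This avoids naming the four vertices. *)
Lemma mem_k4e_deg v (B : {set {set 'I_v}}) x y : is_k4e B ->
  ([set x; y] \in B) =
  [&& x != y, 1 < deg B x, 1 < deg B y & (deg B x == 3) || (deg B y == 3)].
Proof.
move=> [a [b [c [d [U ->]]]]]; have ne := uniq4_neq U.
rewrite mem_k4e // !deg_k4e // !inE.
have [nx|nx] := seq4P a b c d x; last by rewrite !nx !andbF.
have [ny|ny] := seq4P a b c d y; last by rewrite !ny !andbF.
by case: nx => ->; case: ny => ->; rewrite ?eqxx ?ne.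
Qed.

Lemma deg_k4e4 v (a b c d : 'I_v) : uniq [:: a; b; c; d] ->
  let B := k4e_graph a b c d in
  [/\ deg B a = 3, deg B b = 3, deg B c = 2 & deg B d = 2].
Proof. by move=> U B; have ne := uniq4_neq U; split; rewrite deg_k4e // !inE ?eqxx ?ne. Qed.

Lemma deg_notin v (a b c d x : 'I_v) : uniq [:: a; b; c; d] ->
  x \notin [:: a; b; c; d] -> deg (k4e_graph a b c d) x = 0.
Proof. by move=> U; rewrite deg_k4e // !inE !negb_or =>
  /and4P[/negPf-> /negPf-> /negPf-> /negPf->]. Qed.

(** * Blocks between hubs and blocks among the other points *)

Section Structure.
Variable Bs : {set {set {set 'I_10}}}.
Hypothesis D : is_design Bs.
Local Notation hubs := (hubs Bs).
Let kB B := D.1 B.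

Lemma nonhub_deg2 B x : B \in Bs -> deg B x = 2 -> x \notin hubs.
Proof.
move=> BBs dx; apply/negP => /(ndeg_hub D)[_] /eqP; rewrite cards_eq0 => /eqP/setP/(_ B).
by rewrite !inE BBs dx.
Qed.

(** A hub has degree 3 in every block through it, so the block containing an edge between two hubs
    has both of them as central vertices. *)
Lemma hub_block x y : x \in hubs -> y \in hubs -> x != y ->
  exists z w, uniq [:: x; y; z; w] /\ k4e_graph x y z w \in Bs.
Proof.
move=> xh yh nxy; have [B BBs] := design_block_ex D nxy.
rewrite mem_k4e_deg; last exact: kB.
case/and4P=> _ dx dy _.
have deg3 u : u \in hubs -> 1 < deg B u -> deg B u = 3.
  move=> uh; have : deg B u != 2 by apply: contraTneq uh; apply: nonhub_deg2.
  move=> /negPf n2; have := deg_k4e_split u (kB BBs); rewrite n2.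
  by case: eqP => //= _ ->.
have [z [w [U EB]]] := deg_center2 (kB BBs) (deg3 _ xh dx) (deg3 _ yh dy) nxy.
by exists z, w; rewrite -EB.
Qed.

Lemma nonhub_center_uniq x B C : x \notin hubs -> B \in Bs -> C \in Bs ->
  deg B x = 3 -> deg C x = 3 -> B = C.
Proof.
move=> /(ndeg_nonhub D)[/eqP/cards1P[E EE] _] BBs CBs dB dC.
have /set1P-> : B \in [set E] by rewrite -EE inE BBs dB.
by have /set1P-> : C \in [set E] by rewrite -EE inE CBs dC.
Qed.

Lemma nonhub_center_ex x : x \notin hubs -> exists2 B, B \in Bs & deg B x = 3.
Proof.
move=> /(ndeg_nonhub D)[/eqP/cards1P[E EE] _].
by have := set11 E; rewrite -EE inE => /andP[? /eqP ?]; exists E.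
Qed.

(** For two hubs this is the pair of outer vertices of the block with central edge [x], [y]. The
    existential form is symmetric in [x] and [y] and requires no choice of that block. *)
Definition rims x y :=
  [set z | [exists B in Bs, [&& deg B x == 3, deg B y == 3 & deg B z == 2]]].

Lemma rimsC x y : rims x y = rims y x.
Proof.
by apply/setP => z; rewrite !inE; apply: eq_existsb => B; rewrite [(deg B x == 3) && _]andbCA.
Qed.

Lemma rimsE x y z w : uniq [:: x; y; z; w] -> k4e_graph x y z w \in Bs ->
  rims x y = [set z; w].
Proof.
move=> U BBs; have ne := uniq4_neq U; have [dx dy dz dw] := deg_k4e4 U.
apply/setP => u; rewrite !inE; apply/exists_inP/idP =>
  [[C CBs /and3P[/eqP cx /eqP cy /eqP cu]]|].
  have EC : C = k4e_graph x y z w.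
    apply: (design_block_uniq D CBs BBs (negbT ne.1.1.1.1.1.1)).
      by rewrite mem_k4e_deg ?cx ?cy ?ne //; apply: kB.
    by rewrite mem_k4e_deg ?dx ?dy ?ne //; apply: kB.
  move: cu; rewrite EC deg_k4e // !inE.
  by have [nu|nu] := seq4P x y z w u; [case: nu => -> | ]; rewrite ?nu ?eqxx ?ne.
move=> uzw; exists (k4e_graph x y z w); rewrite // dx dy.
by case/orP: uzw => /eqP->; rewrite ?dz ?dw.
Qed.

Lemma rims_card x y : x \in hubs -> y \in hubs -> x != y -> #|rims x y| = 2.
Proof.
move=> xh yh nxy; have [z [w [U BBs]]] := hub_block xh yh nxy.
by rewrite (rimsE U BBs) cards2 (uniq4_neq U).
Qed.

Lemma rims_nonhub x y : rims x y \subset ~: hubs.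
Proof.
apply/subsetP => z; rewrite inE => /exists_inP[B BBs /and3P[_ _ /eqP dz]].
by rewrite inE (nonhub_deg2 BBs).
Qed.

(** A common element [t] would put the edge [x], [t] in both blocks; they would coincide and have
    three central vertices. *)
Lemma rims_disjoint x y z : x \in hubs -> y \in hubs -> x != y -> y != z -> x != z ->
  [disjoint rims x y & rims x z].
Proof.
move=> xh yh nxy nyz nxz; have [u [w [U BBs]]] := hub_block xh yh nxy.
rewrite -setI_eq0; apply/eqP/setP => t; rewrite !inE; apply/negP => /andP[].
case/exists_inP=> B {u w U}BBs /and3P[/eqP dx /eqP dy /eqP dt].
case/exists_inP=> C CBs /and3P[/eqP cx /eqP cz /eqP ct].
have nxt : x != t by apply/eqP => E; rewrite E dt in dx.
have EC : C = B.
  apply: (design_block_uniq D CBs BBs nxt).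
    by rewrite mem_k4e_deg ?nxt ?cx ?ct //; apply: kB.
  by rewrite mem_k4e_deg ?nxt ?dx ?dt //; apply: kB.
have [u [w [U EB]]] := deg_center2 (kB BBs) dx dy nxy.
move: cz; rewrite EC EB deg_k4e // !inE ![z == _]eq_sym (negPf nxz) (negPf nyz).
by do 2!case: (_ == _).
Qed.

Lemma card_nonhubs : #|~: hubs| = 6.
Proof. by have := cardsC hubs; rewrite card_hubs // card_ord; lia. Qed.

(** Three disjoint pairs inside the six non-hubs exhaust them. *)
Lemma rims_cover i j k l : uniq [:: i; j; k; l] -> all (mem hubs) [:: i; j; k; l] ->
  rims i j :|: rims i k :|: rims i l = ~: hubs.
Proof.
move=> U /and5P[/= ih jh kh lh _]; have ne := uniq4_neq U.
apply/eqP; rewrite eqEcard !subUset !rims_nonhub /=.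
have dis x y z : x \in hubs -> y \in hubs -> uniq [:: x; y; z] -> rims x y :&: rims x z = set0.
  move=> xh yh /=; rewrite !inE negb_or => /and3P[/andP[? ?] ? _].
  by apply/eqP; rewrite setI_eq0; apply: rims_disjoint.
rewrite card_nonhubs !cardsU setIUl !dis ?setU0 ?cards0 ?subn0 ?rims_card //=;
  by rewrite ?inE ?ne.
Qed.

(* The rims of complementary hub pairs coincide: both are what remains of the
   non-hubs after removing the rims of [ik] and [il], resp. of [ki] and [li]. *)
Lemma rims_opposite i j k l : uniq [:: i; j; k; l] -> all (mem hubs) [:: i; j; k; l] ->
  rims k l = rims i j.
Proof.
move=> U A; have := A => /and5P[/= ih jh kh lh _]; have ne := uniq4_neq U.
apply/eqP; rewrite eqEcard !rims_card ?ne // andbT.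
apply/subsetP => z zkl; have : z \in ~: hubs by apply: (subsetP (rims_nonhub k l)).
have dis x y : x \in hubs -> y \in hubs -> x != y -> y != i -> x != i ->
    z \in rims x y -> z \in rims i x -> false.
  move=> xh yh nxy nyi nxi zxy; rewrite rimsC.
  by rewrite (disjointFr (rims_disjoint xh yh nxy nyi nxi) zxy).
rewrite -(rims_cover U A) 2!in_setU -orbA => /or3P[//||] zi.
  by have := dis k l kh lh; rewrite !ne => /(_ isT isT isT zkl zi).
rewrite rimsC in zkl.
by have := dis l k lh kh; rewrite !ne => /(_ isT isT isT zkl zi).
Qed.

Lemma other_hubs x : x \in hubs ->
  exists j k l, uniq [:: x; j; k; l] /\ all (mem hubs) [:: x; j; k; l].
Proof.
move=> xh; have : size (enum (hubs :\ x)) = 3.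
  by rewrite -cardE; have := cardsD1 x hubs; rewrite card_hubs // xh; lia.
have : uniq (x :: enum (hubs :\ x)) by rewrite /= mem_enum !inE eqxx enum_uniq.
have : all (mem hubs) (x :: enum (hubs :\ x)).
  by rewrite /= xh; apply/allP => y; rewrite mem_enum !inE => /andP[].
by case: (enum _) => [|j [|k [|l []]]] //; exists j, k, l.
Qed.

(** If the central partner [e] of [d] were a hub, then [d] would lie in one of the rims at [e], and
    the edge [e], [d] would also be in a block where [d] has degree 2. *)
Lemma nonhub_block d : d \notin hubs -> exists e x y,
  [/\ uniq [:: d; e; x; y], k4e_graph d e x y \in Bs & all [predC hubs] [:: d; e; x; y]].
Proof.
move=> dh; have [B BBs dd] := nonhub_center_ex dh.
have [e [x [y [U EB]]]] := deg_center (kB BBs) dd; exists e, x, y.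
have [d3 e3 x2 y2] := deg_k4e4 U; rewrite -EB in d3 e3 x2 y2 *.
split=> //.
suff eh : e \notin hubs by apply/and5P; split;
  rewrite //= ?(nonhub_deg2 BBs x2) ?(nonhub_deg2 BBs y2).
apply/negP => eh; have [j [k [l [Uh A]]]] := other_hubs eh.
have : d \in ~: hubs by rewrite inE.
have ned : e != d by rewrite eq_sym (uniq4_neq U).
rewrite -(rims_cover Uh A) => drim.
have [C CBs [c3 c2]] : exists2 C, C \in Bs & deg C e = 3 /\ deg C d = 2.
  by move: drim; rewrite !inE => /orP[/orP[]|] /exists_inP[C CBs /and3P[/eqP ? _ /eqP ?]];
    exists C.
have EC : C = B.
  apply: (design_block_uniq D CBs BBs ned).
    by rewrite mem_k4e_deg ?ned ?c3 ?c2 //; apply: kB.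
  by rewrite mem_k4e_deg ?ned ?e3 ?dd //; apply: kB.
by rewrite EC dd in c2.
Qed.

(** The block [C] in which [x] is central contains neither [d] nor [e], because it would share with
    the given block an edge at [x]. Hence [C] lives on [x], [y], [f], [g], and it remains to see
    that [y] is its other central vertex. *)
Lemma next_block d e x y f g : uniq [:: d; e; x; y; f; g] ->
  all [predC hubs] [:: d; e; x; y; f; g] -> k4e_graph d e x y \in Bs ->
  k4e_graph x y f g \in Bs.
Proof.
move=> U6 A BBs.
have U : uniq [:: d; e; x; y] by move: U6; rewrite -[_ :: _]/([:: d; e; x; y] ++ [:: f;
  g]) cat_uniq => /andP[].
have ne := uniq4_neq U; have [d3 e3 x2 y2] := deg_k4e4 U.
set B := k4e_graph d e x y in BBs d3 e3 x2 y2.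
have NH z : z \in [:: d; e; x; y; f; g] -> z \notin hubs by move=> zi; have := allP A z zi.
have xh : x \notin hubs by apply: NH; rewrite !inE eqxx !orbT.
have [f' [u [w [UC CBs AC]]]] := nonhub_block xh.
have neC := uniq4_neq UC; have [cx cf cu cw] := deg_k4e4 UC.
set C := k4e_graph x f' u w in CBs cx cf cu cw.
have nBC : C <> B by move=> E; rewrite E x2 in cx.
have six z : z \notin hubs -> z \in [:: d; e; x; y; f; g].
  move=> zh; have : [set t in [:: d; e; x; y; f; g]] = ~: hubs.
    apply/eqP; rewrite eqEcard card_nonhubs cardsE (card_uniqP U6) leqnn andbT.
    by apply/subsetP => t; rewrite !inE => ti; have := allP A t; rewrite !inE => ->.
  by move=> /setP/(_ z); rewrite [in RHS]inE zh inE.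
have center z : deg B z = 3 -> deg C z != 3.
  move=> bz; apply/eqP => cz; apply: nBC; apply: (nonhub_center_uniq _ CBs BBs cz bz).
  apply: NH; have [nz|nz] := seq4P d e x y z.
    by case: nz => ->; rewrite !inE eqxx ?orbT.
  by move: bz; rewrite /B deg_k4e // !inE !nz.
have rimC z : deg B z = 3 -> deg C z != 2.
  move=> bz; apply/eqP => cz; apply: nBC.
  have nxz : x != z by apply/eqP => E; rewrite E bz in x2.
  apply: (design_block_uniq D CBs BBs nxz).
    by rewrite mem_k4e_deg ?nxz ?cx ?cz //; apply: kB.
  by rewrite mem_k4e_deg ?nxz ?x2 ?bz //; apply: kB.
have nde z : z \in [:: x; f'; u; w] -> (z != d) && (z != e).
  move=> zi; have cz : (deg C z == 3) || (deg C z == 2).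
    by move: zi; rewrite !inE => /or4P[] /eqP->; rewrite ?cx ?cf ?cu ?cw.
  apply/andP; split; apply/eqP => E; move: cz; rewrite E;
  by rewrite (negPf (center _ _)) // (negPf (rimC _ _)).
(* Otherwise consider the edge [f'], [d]. One of its ends is central in the block containing it, so
   that block is [C] or [B]; but [d] is not in [C] and [f'] is not in [B]. *)
have fy : f' = y.
  apply/eqP/negP => /negP nfy.
  have nfd : f' != d by have /andP[] := nde f' ltac:(by rewrite !inE eqxx orbT).
  have [E EBs] := design_block_ex D nfd.
  have f'h : f' \notin hubs by move: AC => /and4P[].
  have dh : d \notin hubs by apply: NH; rewrite inE eqxx.
  rewrite mem_k4e_deg; last exact: kB.
  case/and4P=> _ e1 e2 /orP[] /eqP E3.
    have EC := nonhub_center_uniq f'h EBs CBs E3 cf.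
    move: e2; rewrite EC deg_notin //.
    by apply/negP => /nde; rewrite eqxx.
  have EB := nonhub_center_uniq dh EBs BBs E3 d3.
  move: e1; rewrite EB deg_notin // !inE (negPf nfy) (negPf nfd).
  have /andP[_ /negPf->] := nde f' ltac:(by rewrite !inE eqxx orbT).
  by rewrite neC.
have fg z : z \in [:: u; w] -> (z == f) || (z == g).
  move=> zi; have zi4 : z \in [:: x; f'; u; w] by rewrite 2!in_cons zi !orbT.
  have /andP[/negPf nd /negPf nE] := nde z zi4.
  have zh : z \notin hubs by have := allP AC z zi4.
  have := six z zh; rewrite 4!in_cons nd nE /= !inE.
  by move: zi; rewrite !inE => /orP[] /eqP->; rewrite ?neC -?fy ?neC.
move: (fg u) (fg w); rewrite !inE !eqxx orbT => /(_ isT) uf /(_ isT) wf.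
rewrite /C fy in CBs.
case/orP: uf => /eqP Eu; case/orP: wf => /eqP Ew; move: CBs; rewrite Eu Ew //.
- by have := neC.1.2; rewrite Eu Ew eqxx.
- by rewrite k4eCr.
- by have := neC.1.2; rewrite Eu Ew eqxx.
Qed.

End Structure.

(** * Encoding of designs by lists *)

Definition quad (T : Type) : Type := (T * T * T * T)%type.

(** The blocks are grouped by the perfect matchings 01|23, 02|13, 03|12 of the hubs; both edges of a
    matching receive the same two consecutive entries of [n]. *)
Definition hub_quads (T : Type) (a n : seq T) : seq (quad T) :=
  match a, n with
  | [:: a0; a1; a2; a3], [:: n0; n1; n2; n3; n4; n5] =>
    [:: (a0, a1, n0, n1); (a2, a3, n0, n1); (a0, a2, n2, n3);
        (a1, a3, n2, n3); (a0, a3, n4, n5); (a1, a2, n4, n5)]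
  | _, _ => [::]
  end.

Definition nonhub_quads (T : Type) (m : seq T) : seq (quad T) :=
  if m is [:: m0; m1; m2; m3; m4; m5] then
    [:: (m0, m1, m2, m3); (m2, m3, m4, m5); (m4, m5, m0, m1)]
  else [::].

Definition pairs_increasing (s : seq nat) :=
  if s is [:: x0; x1; x2; x3; x4; x5] then [&& x0 < x1, x2 < x3 & x4 < x5]
  else false.

(** The 90 ordered partitions of six positions into pairs. The order inside a pair is immaterial,
    but the order of the pairs decides which matching gets which pair. *)
Definition splits := Eval vm_compute in
  [seq s <- permutations (iota 0 6) | pairs_increasing s].

(** Rotating the three pairs does not change the cyclic part, so the pair containing the smallest
    point may come first; 30 partitions remain. *)
Definition splits0 := Eval vm_compute in [seq s <- splits | head 0 s == 0].

(* Membership through [eqn]: the overloaded [\in] makes the enumerations below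
   an order of magnitude slower to evaluate. *)
Definition natmem (x : nat) (s : seq nat) := has (eqn x) s.

Definition rest (a : seq nat) := [seq x <- iota 0 10 | ~~ natmem x a].

(** Reading [s] as positions among the points outside [a] lets the same [splits] serve every choice
    of hubs. *)
Definition subrest (a s : seq nat) := map (nth 0 (rest a)) s.

Definition design_quads (a n m : seq nat) := hub_quads a n ++ nonhub_quads m.

Definition std_quads (r : seq nat) := design_quads (iota 0 4) r (iota 4 6).

(* The partitions [N] for the hubs 0..3 and the cycle of pairs 45, 67, 89: [N]
   has three, one or no pair in common with the cycle. *)
Definition reps :=
  [:: [:: 4; 5; 6; 7; 8; 9]; [:: 4; 5; 6; 8; 7; 9]; [:: 5; 6; 7; 8; 9; 4]].

Definition blk (T : Type) v (f : T -> 'I_v) (q : quad T) : {set {set 'I_v}} :=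
  let: (a, b, c, d) := q in k4e_graph (f a) (f b) (f c) (f d).

Definition bset (T : Type) v (f : T -> 'I_v) (l : seq (quad T)) : {set {set {set 'I_v}}} :=
  [set B in map (blk f) l].

Lemma sorted_enum_val n (A : {set 'I_n}) : sorted ltn (map val (enum A)).
Proof.
rewrite sorted_map /enum_mem; apply: sorted_filter.
  by move=> ? ? ?; apply: ltn_trans.
by rewrite -enumT -sorted_map val_enum_ord iota_ltn_sorted.
Qed.

Lemma splitsE : splits = [seq s <- permutations (iota 0 6) | pairs_increasing s].
Proof. by vm_compute. Qed.

Lemma splits0E : splits0 = [seq s <- splits | head 0 s == 0].
Proof. by vm_compute. Qed.

Lemma split_index (ds n : seq nat) : sorted ltn ds -> size ds = 6 ->
  perm_eq n ds -> pairs_increasing n ->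
  map (index^~ ds) n \in splits /\ map (nth 0 ds) (map (index^~ ds) n) = n.
Proof.
move=> sds ds6 pn inc; have uds : uniq ds by apply: sorted_uniq sds => [? ? ?|?]; [exact:
  ltn_trans|exact: ltnn].
split; last first.
  rewrite -map_comp -[RHS]map_id; apply/eq_in_map => x xn /=.
  by rewrite nth_index // -(perm_mem pn).
rewrite splitsE mem_filter mem_permutations; apply/andP; split; last first.
  rewrite (perm_trans (perm_map _ pn)) //.
  suff -> : map (index^~ ds) ds = iota 0 6 by [].
  apply: (@eq_from_nth _ 0) => [|i]; rewrite size_map ?ds6 // => i6.
  by rewrite (nth_map 0) ?ds6 // nth_iota // index_uniq ?ds6.
(* Positions in an increasing list preserve the order, so the pairs stay increasing. *)
have mono x y : x \in n -> y \in n -> x < y -> index x ds < index y ds.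
  rewrite !(perm_mem pn) => xd yd xy; rewrite ltnNge; apply/negP.
  rewrite leq_eqVlt => /orP[/eqP E|lt].
    by move: xy; rewrite -(nth_index 0 xd) -(nth_index 0 yd) E ltnn.
  have /(_ _ _ _ _ lt) := sorted_ltn_index ltn_trans sds.
  by move=> /(_ yd xd) => /ltnW; rewrite leqNgt xy.
case: n inc mono {pn} => [|x0 [|x1 [|x2 [|x3 [|x4 [|x5 []]]]]]] // /and3P[h1 h2 h3] mono /=.
by rewrite !mono // !inE eqxx ?orbT.
Qed.

Lemma enum_card2 n (A : {set 'I_n}) : #|A| = 2 ->
  exists x y, [/\ enum A = [:: x; y], x < y & A = [set x; y]].
Proof.
move=> A2; have := sorted_enum_val A; have : size (enum A) = 2 by rewrite -cardE.
have mA x : (x \in A) = (x \in enum A) by rewrite mem_enum.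
case: (enum A) mA => [|x [|y []]] // mA _ /= /andP[xy _]; exists x, y; split=> //.
by apply/setP => z; rewrite mA !inE.
Qed.

(** * Every design of order 10 has the encoded shape *)

Section Shape.

Variable Bs : {set {set {set 'I_10}}}.
Hypothesis D : is_design Bs.
Local Notation hubs := (hubs Bs).

(** The pairs of [n] are the rims of [a0] with the other hubs, and complementary hub pairs have the
    same rims. Only an inclusion is stated; equality will follow by counting blocks. *)
Lemma hub_shape : exists a n : seq 'I_10,
  [/\ a = enum hubs, perm_eq n (enum (~: hubs)), pairs_increasing (map val n) &
    forall x y z w, x \in hubs -> y \in hubs -> uniq [:: x; y; z; w] ->
      k4e_graph x y z w \in Bs -> k4e_graph x y z w \in bset id (hub_quads a n)].
Proof.
have : size (enum hubs) = 4 by rewrite -cardE card_hubs.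
have hubE x : (x \in hubs) = (x \in enum hubs) by rewrite mem_enum.
have := enum_uniq hubs.
case: (enum hubs) hubE => [|a0 [|a1 [|a2 [|a3 []]]]] // hubE U _.
have ne := uniq4_neq U.
have [h0 h1 h2 h3] : [/\ a0 \in hubs, a1 \in hubs, a2 \in hubs & a3 \in hubs].
  by rewrite !hubE !inE !eqxx ?orbT.
have [n0 [n1 [e01 n01 r01]]] := enum_card2 (rims_card D h0 h1 (negbT ne.1.1.1.1.1.1)).
have [n2 [n3 [e02 n23 r02]]] := enum_card2 (rims_card D h0 h2 (negbT ne.1.1.1.1.1.2)).
have [n4 [n5 [e03 n45 r03]]] := enum_card2 (rims_card D h0 h3 (negbT ne.1.1.1.1.2)).
have cover : [set n0; n1] :|: [set n2; n3] :|: [set n4; n5] = ~: hubs.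
  by rewrite -r01 -r02 -r03; apply: rims_cover; rewrite //= h0 h1 h2 h3.
have r23 : rims Bs a2 a3 = [set n0; n1].
  by rewrite -r01; apply: rims_opposite; rewrite //= h0 h1 h2 h3.
have r13 : rims Bs a1 a3 = [set n2; n3].
  by rewrite -r02; apply: rims_opposite; rewrite /= ?h0 ?h1 ?h2 ?h3 // !inE !ne.
have r12 : rims Bs a1 a2 = [set n4; n5].
  by rewrite -r03; apply: rims_opposite; rewrite /= ?h0 ?h1 ?h2 ?h3 // !inE !ne.
exists [:: a0; a1; a2; a3], [:: n0; n1; n2; n3; n4; n5]; split=> //.
- have mem : enum (~: hubs) =i [:: n0; n1; n2; n3; n4; n5].
    by move=> x; rewrite mem_enum -cover !inE !orbA.
  rewrite perm_sym; apply: uniq_perm => //; first exact: enum_uniq.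
  by rewrite (uniq_size_uniq (enum_uniq _) mem) -cardE card_nonhubs.
- by rewrite /= n01 n23 n45.
move=> x y z w xh yh Uxy BBs; rewrite /bset inE.
have zw := rimsE D Uxy BBs.
(* The central edge and its rim determine the block, whatever the order in which its vertices are
   named. *)
have find i j p q : rims Bs i j = [set p; q] -> (x == i) && (y == j) || (x == j) && (y == i) ->
    k4e_graph x y z w = k4e_graph i j p q.
  move=> rij xy; have : rims Bs x y = [set p; q].
    by move: xy => /orP[] /andP[/eqP-> /eqP->]; rewrite // rimsC.
  rewrite zw => /eqP; rewrite eq_set2.
  move: xy => /orP[] /andP[/eqP-> /eqP->] /orP[] /andP[/eqP-> /eqP->] //.
  - by rewrite k4eCr.
  - by rewrite k4eCl.
  - by rewrite k4eCl k4eCr.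
have nexy : x != y by rewrite (uniq4_neq Uxy).
have f01 := find a0 a1 _ _ r01; have f23 := find a2 a3 _ _ r23.
have f02 := find a0 a2 _ _ r02; have f13 := find a1 a3 _ _ r13.
have f03 := find a0 a3 _ _ r03; have f12 := find a1 a2 _ _ r12.
rewrite /blk !map_cons !in_cons.
move: xh yh; rewrite !hubE !inE => /or4P[] /eqP Ex /or4P[] /eqP Ey; move:
  nexy f01 f23 f02 f13 f03 f12;
  rewrite Ex Ey ?eqxx ?ne //= => _ f01 f23 f02 f13 f03 f12;
  first [rewrite (f01 isT) | rewrite (f23 isT) | rewrite (f02 isT) | rewrite (f13 isT)
    | rewrite (f03 isT) | rewrite (f12 isT)];
  by rewrite eqxx ?orbT.
Qed.

(** Start from the block where the smallest non-hub [d] is central; two uses of [next_block] close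
    the cycle. Every non-hub is central in one of these three blocks and in no other block. *)
Lemma nonhub_shape : exists m : seq 'I_10,
  [/\ perm_eq m (enum (~: hubs)), pairs_increasing (map val m),
    head 0 (map val m) = head 0 (map val (enum (~: hubs))) &
    forall x y z w, x \notin hubs -> uniq [:: x; y; z; w] ->
      k4e_graph x y z w \in Bs -> k4e_graph x y z w \in bset id (nonhub_quads m)].
Proof.
have Esize : size (enum (~: hubs)) = 6 by rewrite -cardE card_nonhubs.
have nhE x : (x \in ~: hubs) = (x \in enum (~: hubs)) by rewrite mem_enum.
have : sorted ltn (map val (enum (~: hubs))) := sorted_enum_val _.
have Euniq := enum_uniq (~: hubs).
case: (enum (~: hubs)) Esize nhE Euniq => [|d ds] // [ds5] nhE Euniq /= dsort.
have dh : d \notin hubs by have := nhE d; rewrite !inE eqxx => ->.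
have [e [x' [y' [U' BBs' A']]]] := nonhub_block D dh.
have [x [y [xy U BBs A]]] : exists x y : 'I_10, [/\ x < y, uniq [:: d; e; x; y],
   k4e_graph d e x y \in Bs & all [predC hubs] [:: d; e; x; y]].
  have ne' := uniq4_neq U'.
  have : x' != y' by rewrite ne'.
  rewrite -val_eqE /= neq_ltn => /orP[xy|yx]; [exists x', y' | exists y', x'] => //.
  split=> //; first by rewrite /= !inE !ne'.
    by rewrite k4eCr.
  by move: A'; rewrite /= [X in [&& _, _ & X]]andbCA.
have [f [g [fg U6 A6]]] : exists f g : 'I_10, [/\ f < g, uniq [:: d; e; x; y; f; g] &
    all [predC hubs] [:: d; e; x; y; f; g]].
  have sub : [set z in [:: d; e; x; y]] \subset ~: hubs.
    by apply/subsetP => z; rewrite !inE => zi; have := allP A z; rewrite !inE; apply.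
  have : #|~: hubs :\: [set z in [:: d; e; x; y]]| = 2.
    by rewrite cardsDS // card_nonhubs // cardsE (card_uniqP U).
  case/enum_card2=> f [g [_ fg /setP E]]; exists f, g.
  have /andP[fn fh] : (f \notin [:: d; e; x; y]) && (f \notin hubs).
    by have := E f; rewrite !inE eqxx.
  have /andP[gn gh] : (g \notin [:: d; e; x; y]) && (g \notin hubs).
    by have := E g; rewrite !inE eqxx orbT.
  split=> //.
    rewrite -[_ :: _]/([:: d; e; x; y] ++ [:: f; g]) cat_uniq U.
    by rewrite /= (negPf fn) (negPf gn) !inE andbT -val_eqE /= neq_ltn fg.
  rewrite -[_ :: _]/([:: d; e; x; y] ++ [:: f; g]) all_cat A.
  by rewrite /= fh gh.
have B2 := next_block D U6 A6 BBs.
have B3 : k4e_graph f g d e \in Bs.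
  apply: (next_block D _ _ B2).
    by rewrite -[_ :: _]/([:: x; y; f; g] ++ [:: d; e]) uniq_catC.
  by rewrite -[_ :: _]/([:: x; y; f; g] ++ [:: d; e]) all_cat andbC -all_cat.
have six z : z \notin hubs -> z \in [:: d; e; x; y; f; g].
  move=> zh; have : [set t in [:: d; e; x; y; f; g]] = ~: hubs.
    apply/eqP; rewrite eqEcard card_nonhubs // cardsE (card_uniqP U6) leqnn andbT.
    by apply/subsetP => t; rewrite !inE => ti; have := allP A6 t; rewrite !inE; apply.
  by move=> /setP/(_ z); rewrite [in RHS]inE zh inE.
have dmin z : z \in ds -> d < z.
  move=> zds; have := order_path_min ltn_trans dsort => /allP; apply.
  exact: map_f.
exists [:: d; e; x; y; f; g]; split=> //.
- apply: uniq_perm => // z; rewrite -nhE; apply/idP/idP => [zi|].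
    by have := allP A6 z zi; rewrite !inE.
  by rewrite inE; apply: six.
- rewrite /= xy fg !andbT; apply: dmin.
  have : e \in ~: hubs by rewrite inE; move: A => /and4P[].
  by rewrite nhE in_cons (uniq4_neq U).
move=> z u w t zh Uz CBs.
have [z3 _ _ _] := deg_k4e4 Uz; set C := k4e_graph z u w t in CBs z3 *.
have [d1 e1 _ _] := deg_k4e4 U.
have ctr z' u' w' t' : uniq [:: z'; u'; w'; t'] -> k4e_graph z' u' w' t' \in Bs ->
    (z == z') || (z == u') -> C = k4e_graph z' u' w' t'.
  move=> U1 B1 zz; apply: (nonhub_center_uniq D zh CBs B1 z3).
  by have [? ? _ _] := deg_k4e4 U1; case/orP: zz => /eqP->.
have U2 : uniq [:: x; y; f; g].
  by move: U6; rewrite -[_ :: _]/([:: d; e] ++ [:: x; y; f; g]) cat_uniq => /and3P[].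
have U3 : uniq [:: f; g; d; e].
  have : uniq ([:: x; y] ++ [:: f; g; d; e]).
    by rewrite -[_ ++ _]/([:: x; y; f; g] ++ [:: d; e]) uniq_catC.
  by rewrite cat_uniq => /and3P[].
rewrite inE !map_cons !in_cons /blk.
have := six z zh; rewrite !in_cons in_nil orbF !orbA -!orbA orbA.
case/orP=> [zi|]; first by rewrite (ctr _ _ _ _ U BBs zi) eqxx.
rewrite orbA => /orP[zi|zi]; first by rewrite (ctr _ _ _ _ U2 B2 zi) eqxx orbT.
by rewrite (ctr _ _ _ _ U3 B3 zi) eqxx !orbT.
Qed.

Lemma design_shape : exists a s t : seq nat,
  [/\ [/\ sorted ltn a, size a = 4 & all (gtn 10) a], s \in splits, t \in splits0 &
      Bs = bset inord (design_quads a (subrest a s) (subrest a t))].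
Proof.
have [a [n [aE pn incn subn]]] := hub_shape.
have [m [pm incm hm subm]] := nonhub_shape.
pose ds := map val (enum (~: hubs)).
have ds6 : size ds = 6 by rewrite size_map -cardE card_nonhubs.
(* Two strictly increasing lists with the same elements are equal. *)
have restE : rest (map val a) = ds.
  apply: (@irr_sorted_eq _ ltn) => [||||x]; [exact: ltn_trans|exact: ltnn| | exact:
    sorted_enum_val | ].
    by apply: sorted_filter; [exact: ltn_trans | exact: iota_ltn_sorted].
  rewrite mem_filter mem_iota /= add0n.
  have natmemE s : natmem x s = (x \in s).
    by rewrite -[RHS]has_pred1 /natmem; apply: eq_has => y /=; rewrite eqnE eq_sym.
  rewrite natmemE aE; apply/andP/mapP => [[xa x10]|[y]].
    exists (Ordinal x10) => //; rewrite mem_enum inE; apply: contra xa => xh.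
    by apply/mapP; exists (Ordinal x10); rewrite // mem_enum.
  rewrite mem_enum inE => yh ->; split; last exact: ltn_ord.
  by rewrite mem_map ?mem_enum //; apply: val_inj.
have [sin sE] := split_index (sorted_enum_val _) ds6 (perm_map val pn) incn.
have [tin tE] := split_index (sorted_enum_val _) ds6 (perm_map val pm) incm.
exists (map val a), (map (index^~ ds) (map val n)), (map (index^~ ds) (map val m)).
split=> //.
- split; rewrite aE ?sorted_enum_val ?size_map -?cardE ?card_hubs //.
  by apply/allP => _ /mapP[y _ ->]; apply: ltn_ord.
- rewrite splits0E mem_filter tin andbT.
  case: (m) hm incm => [|m0 m'] //= hm _.
  rewrite /ds; case: (enum (~: hubs)) hm ds6 => [|d0 ds'] //= -> _.
  by rewrite eqxx.
rewrite /subrest restE sE tE.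
have Bval l : bset inord (map (fun q : quad 'I_10 => let:
  (a, b, c, d) := q in (val a, val b, val c, val d)) l) = bset id l.
  apply/setP => B; rewrite !inE -map_comp; congr (_ \in _); apply/eq_map => -[[[x y] z] w] /=.
  by rewrite !inord_val.
have -> : design_quads (map val a) (map val n) (map val m) =
   map (fun q : quad 'I_10 => let: (a, b, c, d) := q in (val a, val b, val c, val d))
     (hub_quads a n ++ nonhub_quads m).
  rewrite map_cat; congr cat.
    by case: (a) => [|? [|? [|? [|? []]]]] //; case: (n) => [|? [|? [|? [|? [|? [|? []]]]]]].
  by case: (m) => [|? [|? [|? [|? [|? [|? []]]]]]].
(* Inclusion suffices: [Bs] has nine blocks and at most nine are listed. *)
rewrite Bval; apply/eqP; rewrite eqEcard; apply/andP; split.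
  apply/subsetP => B BBs; have [x [y [z [w [U EB]]]]] := D.1 B BBs.
  rewrite inE map_cat mem_cat; rewrite EB in BBs *.
  have [xh|xh] := boolP (x \in hubs); last by have := subm _ _ _ _ xh U BBs; rewrite inE =>
    ->; rewrite orbT.
  have [yh|yh] := boolP (y \in hubs); first by have := subn _ _ _ _ xh yh U BBs;
    rewrite inE => ->.
  (* A mixed central pair is turned round so that the non-hub comes first. *)
  rewrite k4eCl in BBs *.
  have := subm _ _ _ _ yh _ BBs; rewrite inE => ->; rewrite ?orbT //.
  by rewrite /= !inE !(uniq4_neq U).
rewrite (card_design D) /bset cardsE (leq_trans (card_size _)) // size_map size_cat.
(* A list of the wrong length yields no block, so 6 and 3 bound the two parts in every case. *)
by apply: (@leq_add _ _ 6 3); [case: (a) => [|? [|? [|? [|? []]]]] //; case: (n) =>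
  [|? [|? [|? [|? [|? [|? []]]]]]] | case: (m) => [|? [|? [|? [|? [|? [|? []]]]]]]].
Qed.

End Shape.

(** * Enumeration of the possible intersection numbers *)

Definition quad_triangles (q : quad nat) : seq (seq nat) :=
  let: (a, b, c, d) := q in [:: [:: a; b; c]; [:: a; b; d]].

Definition std_triangles (r : seq nat) := flatten (map quad_triangles (std_quads r)).

(** For triples of distinct points inclusion is equality, so this one-sided test recognises a
    triangle in any order of its vertices. *)
Definition sub3 (s t : seq nat) := all (natmem^~ t) s.

Definition triangle_table (ts : seq (seq nat)) : seq (seq (seq bool)) :=
  [seq [seq [seq has (sub3 [:: x; y; z]) ts | z <- iota 0 10]
    | y <- iota 0 10] | x <- iota 0 10].

Definition lookup (tb : seq (seq (seq bool))) (x y z : nat) : bool :=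
  nth false (nth [::] (nth [::] tb x) y) z.

(* Adds to [(s, t)] the numbers of blocks and of triangles which the blocks [l]
   share with the design whose triangles are tabulated in [tb]. *)
Fixpoint score (tb : seq (seq (seq bool))) (l : seq (quad nat)) (s t : nat) : nat * nat :=
  if l is (a, b, c, d) :: l' then
    if lookup tb a b c then
      if lookup tb a b d then score tb l' s.+1 t.+2 else score tb l' s t.+1
    else if lookup tb a b d then score tb l' s t.+1 else score tb l' s t
  else (s, t).

Definition pair_sum (u v : nat * nat) := let: (a, b) := u in let:
  (c, d) := v in (a + c, b + d).

Definition mem_pair (u : nat * nat) (s : seq (nat * nat)) :=
  let: (a, b) := u in
  has (fun v : nat * nat => let: (c, d) := v in if eqn a c then eqn b d else false) s.

Fixpoint undup_pairs (s acc : seq (nat * nat)) :=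
  if s is u :: s' then
    if mem_pair u acc then undup_pairs s' acc else undup_pairs s' (u :: acc)
  else acc.

(** The second coordinate counts all common triangles, that is [t + 2 * s] in terms of [Fin]. *)
Definition spectrum : seq (nat * nat) :=
  [:: (0, 0); (0, 1); (0, 2); (0, 3); (0, 4); (0, 5); (0, 6); (0, 7); (0, 8); (0, 9);
      (1, 2); (1, 3); (1, 4); (1, 5); (1, 6); (1, 7); (1, 8); (1, 9);
      (2, 4); (2, 5); (2, 6); (2, 7); (2, 8); (2, 9); (2, 10); (2, 11);
      (3, 6); (3, 8); (3, 9); (3, 10); (3, 12); (4, 8); (4, 10); (4, 12);
      (5, 10); (5, 14); (6, 12); (6, 14); (6, 15); (9, 18)].

(** Scores add up over the two independent parts, so it is enough to combine the distinct partial
    scores instead of visiting all 90 times 30 designs with hubs [a]. *)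
Definition spectrum_check (tb : seq (seq (seq bool))) (a : seq nat) :=
  let us := undup_pairs [seq score tb (hub_quads a (subrest a s)) 0 0 | s <- splits] [::] in
  let vs := undup_pairs [seq score tb (nonhub_quads (subrest a s)) 0 0 | s <- splits0] [::] in
  all (fun u => all (fun v => mem_pair (pair_sum u v) spectrum) vs) us.

(** Ranges over the 210 four-element sets of points as increasing lists; [iota i.+1 (9 - i)] is the
    interval from i + 1 to 9. *)
Definition all_hubs (P : seq nat -> bool) :=
  all (fun i => all (fun j => all (fun k => all (fun l => P [:: i; j; k; l])
    (iota k.+1 (9 - k))) (iota j.+1 (9 - j))) (iota i.+1 (9 - i))) (iota 0 10).

Lemma spectrum_checked :
  all (fun r => let tb := triangle_table (std_triangles r) in all_hubs (spectrum_check tb))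
    reps.
Proof. by vm_compute. Qed.

(** * Computational reduction to three representatives *)

Definition same_pair (a b c d : nat) := eqn a c && eqn b d || eqn a d && eqn b c.

Definition same_quad (p q : quad nat) :=
  let: (a, b, c, d) := p in let: (a', b', c', d') := q in
  same_pair a b a' b' && same_pair c d c' d'.

Definition sub_quads (l l' : seq (quad nat)) := all (fun p => has (same_quad p) l') l.

(** The 24 symmetries of the cyclic part: rotations of the three pairs combined with swaps inside
    the pairs. *)
Definition nonhub_autos := Eval vm_compute in
  [seq u <- permutations (iota 0 6)
     | sub_quads (nonhub_quads (iota 0 6)) (nonhub_quads u)].

(** The permutations fixing hub 0 induce each permutation of the three perfect matchings exactly
    once; only that action affects the hub part. *)
Definition hub_perms :=
  [:: [:: 0; 1; 2; 3]; [:: 0; 1; 3; 2]; [:: 0; 2; 1; 3];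
      [:: 0; 2; 3; 1]; [:: 0; 3; 1; 2]; [:: 0; 3; 2; 1]].

Definition same_split (s t : seq nat) :=
  match s, t with
  | [:: x0; x1; x2; x3; x4; x5], [:: y0; y1; y2; y3; y4; y5] =>
    let P a b := same_pair a b y0 y1 || (same_pair a b y2 y3 || same_pair a b y4 y5) in
    P x0 x1 && (P x2 x3 && P x4 x5)
  | _, _ => false
  end.

(** The relabelling sought sends 0, ..., 3 to [p] and 4, ..., 9 to [m], carrying the representative
    [r] to the given design. Comparing unordered partitions by [same_split] discards unsuitable [r]
    and [u] before any [p] is tried. *)
Definition normal_check (s t : seq nat) :=
  has (fun r => has (fun u =>
    let m := map (fun i => 4 + nth 0 t i) u in
    if same_split (map (fun i => nth 0 m (i - 4)) r) (map (addn 4) s) then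
      has (fun p => uniq (p ++ m) && (all (gtn 10) (p ++ m) &&
         sub_quads (design_quads (iota 0 4) (map (addn 4) s) (map (addn 4) t))
                   (design_quads p (map (nth 0 (p ++ m)) r) m))) hub_perms
    else false) nonhub_autos) reps.

Lemma normal_checked : all (fun s => all (normal_check s) splits0) splits.
Proof. by vm_compute. Qed.

(** The five listed pairs are edges of a genuine block, hence join distinct points; and [c = d]
    would leave at most three edges. *)
Lemma k4e_uniq v (a b c d : 'I_v) : is_k4e (k4e_graph a b c d) -> uniq [:: a; b; c; d].
Proof.
move=> kB; have card5 : #|k4e_graph a b c d| = 5.
  by case: kB => [a' [b' [c' [d' [U ->]]]]]; apply: card_k4e.
have nexy x y : [set x; y] \in k4e_graph a b c d -> x != y.
  by case: kB => [a' [b' [c' [d' [U ->]]]]]; rewrite mem_k4e // => /and3P[].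
have ab := nexy a b ltac:(by rewrite !inE eqxx).
have ac := nexy a c ltac:(by rewrite !inE eqxx ?orbT).
have ad := nexy a d ltac:(by rewrite !inE eqxx ?orbT).
have bc := nexy b c ltac:(by rewrite !inE eqxx ?orbT).
have bd := nexy b d ltac:(by rewrite !inE eqxx ?orbT).
rewrite /= !inE !negb_or ab ac ad bc bd /= andbT.
apply: contra_eqN card5 => /eqP->; rewrite neq_ltn; apply/orP; left.
have -> : k4e_graph a b d d = [set a; b] |: [set [set a; d]; [set b; d]].
  by apply/setP => e; rewrite !inE; do 3!case: (e == _).
by rewrite cardsU1 cards2; case: (_ \notin _); case: (_ != _).
Qed.

(** * Invariance under relabelling of the points *)

Section Relabel.
Variables (v : nat) (f : 'I_v -> 'I_v).
Hypothesis f_inj : injective f.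
Implicit Types (B : {set {set 'I_v}}) (Bs : {set {set {set 'I_v}}}).

Definition relabel (B : {set {set 'I_v}}) : {set {set 'I_v}} :=
  (fun e : {set 'I_v} => f @: e) @: B.

Lemma relabel_inj : injective relabel.
Proof. exact/imset_inj/imset_inj. Qed.

Lemma imset_set2 x y : f @: [set x; y] = [set f x; f y].
Proof. by rewrite imsetU !imset_set1. Qed.

Lemma relabel_k4e a b c d :
  relabel (k4e_graph a b c d) = k4e_graph (f a) (f b) (f c) (f d).
Proof. by rewrite /relabel /k4e_graph !imsetU !imset_set1 !imset_set2. Qed.

Lemma relabel_is_k4e B : is_k4e B -> is_k4e (relabel B).
Proof.
move=> [a [b [c [d [U ->]]]]]; exists (f a), (f b), (f c), (f d).
by rewrite relabel_k4e -[[:: _; _; _; _]]/(map f [:: a; b; c; d]) map_inj_uniq.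
Qed.

Lemma relabel_design Bs : is_design Bs -> is_design (relabel @: Bs).
Proof.
move=> [k D]; split=> [_ /imsetP[B BBs ->]|x y nxy]; first exact/relabel_is_k4e/k.
have [g fg gf] : bijective f by apply: injF_bij.
have nxy' : g x != g y by rewrite (can_eq gf).
rewrite -(D _ _ nxy') -[RHS](card_imset _ relabel_inj); congr #|pred_of_set _|;
  apply/setP => B.
rewrite inE; apply/andP/imsetP => [[/imsetP[C CBs ->]]|[C]].
  rewrite -{1}(gf x) -{1}(gf y) -imset_set2 => /imsetP[e eC /(imset_inj f_inj) E].
  by exists C; rewrite // inE CBs E.
rewrite inE => /andP[CBs xyC] ->; split; first exact: imset_f.
by rewrite -{1}(gf x) -{1}(gf y) -imset_set2; apply: imset_f.
Qed.

Lemma relabel_triangles B : is_k4e B ->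
  triangles (relabel B) = (fun t : {set 'I_v} => f @: t) @: triangles B.
Proof.
move=> [a [b [c [d [U ->]]]]]; rewrite relabel_k4e !triangles_k4e //; last first.
  by rewrite -[[:: _; _; _; _]]/(map f [:: a; b; c; d]) map_inj_uniq.
by rewrite imsetU !imset_set1 !imsetU !imset_set1.
Qed.

Lemma relabel_trianglesD Bs : is_design Bs ->
  trianglesD (relabel @: Bs) = (fun t : {set 'I_v} => f @: t) @: trianglesD Bs.
Proof.
move=> [k _]; apply/setP => t; apply/bigcupP/imsetP => [[_ /imsetP[B BBs ->]]|[u]].
  rewrite relabel_triangles; last exact: k.
  by case/imsetP=> u uB ->; exists u => //; apply/bigcupP; exists B.
case/bigcupP=> B BBs uB ->; exists (relabel B); first exact: imset_f.
by rewrite relabel_triangles; [apply: imset_f | apply: k].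
Qed.

Lemma relabel_common_blocks Bs1 Bs2 :
  #|(relabel @: Bs1) :&: (relabel @: Bs2)| = #|Bs1 :&: Bs2|.
Proof.
by rewrite -imsetI ?card_imset // => [|? ? _ _]; exact: relabel_inj.
Qed.

Lemma relabel_common_triangles Bs1 Bs2 : is_design Bs1 -> is_design Bs2 ->
  #|trianglesD (relabel @: Bs1) :&: trianglesD (relabel @: Bs2)| =
  #|trianglesD Bs1 :&: trianglesD Bs2|.
Proof.
move=> D1 D2; rewrite !relabel_trianglesD //.
by rewrite -imsetI ?card_imset // => [|? ? _ _]; exact: imset_inj.
Qed.

End Relabel.

(** * Correctness of the tabulated scores *)

Lemma natmemE x s : natmem x s = (x \in s).
Proof. by rewrite -[RHS]has_pred1 /natmem; apply: eq_has => y /=; rewrite eqnE eq_sym. Qed.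

(** The cardinality hypothesis says that no block is listed twice, which turns the sum over the set
    into a sum over the list. *)
Lemma sum_bset n (f : nat -> 'I_n) l (F : {set {set 'I_n}} -> nat) :
  #|bset f l| = size l -> \sum_(B in bset f l) F B = \sum_(q <- l) F (blk f q).
Proof.
rewrite /bset cardsE -(size_map (blk f) l) => /card_uniqP U.
rewrite -(big_map (blk f) xpredT F) [RHS]big_uniq //=.
by apply: eq_bigl => B; rewrite inE.
Qed.

Lemma lookupE ts x y z : x < 10 -> y < 10 -> z < 10 ->
  lookup (triangle_table ts) x y z = has (sub3 [:: x; y; z]) ts.
Proof.
move=> x10 y10 z10; rewrite /lookup /triangle_table.
by rewrite (nth_map 0) ?size_iota // (nth_map 0) ?size_iota // (nth_map 0) ?size_iota //
  !nth_iota.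
Qed.

Definition quad_ok (q : quad nat) :=
  let: (a, b, c, d) := q in uniq [:: a; b; c; d] && all (gtn 10) [:: a; b; c; d].

Local Notation o := (@inord 9).

(** Below 10 the map [inord] is injective, whereas it sends every larger number to 0. *)
Lemma inord_uniq s : all (gtn 10) s -> uniq (map o s) = uniq s.
Proof.
move=> /allP s10; apply: map_inj_in_uniq => x y xs ys /(congr1 val).
by rewrite /= !inordK //; [apply: s10 ys | apply: s10 xs].
Qed.

Lemma sub3E a b c x y z : uniq [:: a; b; c] -> all (gtn 10) [:: a; b; c] ->
  uniq [:: x; y; z] -> all (gtn 10) [:: x; y; z] ->
  ([set o x; o y; o z] == [set o a; o b; o c]) = sub3 [:: x; y; z] [:: a; b; c].
Proof.
have setE u v w : [set o u; o v; o w] = [set i in map o [:: u; v; w]].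
  by apply/setP => i; rewrite !inE orbA.
move=> Ua a10 Ux x10; rewrite !setE eqEcard !cardsE.
have card3 s : uniq s -> all (gtn 10) s -> #|map o s| = size s.
  by move=> Us s10; rewrite (card_uniqP _) ?size_map // inord_uniq.
rewrite !card3 // leqnn andbT; apply/subsetP/allP => [sub t ti|sub i].
  have /sub : o t \in [set i in map o [:: x; y; z]] by rewrite in_set map_f.
  rewrite in_set natmemE => /mapP[u ua /(congr1 val)].
  by rewrite /= !inordK; [move=> -> | exact: (allP a10) | exact: (allP x10)].
rewrite !in_set => /mapP[u ux ->]; apply: map_f.
by have := sub u ux; rewrite natmemE.
Qed.

Lemma std_triangleP r x y z : all quad_ok (std_quads r) ->
  uniq [:: x; y; z] -> all (gtn 10) [:: x; y; z] ->
  ([set o x; o y; o z] \in trianglesD (bset o (std_quads r))) =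
  lookup (triangle_table (std_triangles r)) x y z.
Proof.
move=> ok U x10; have /and4P[h1 h2 h3 _] := x10; rewrite lookupE //.
have okT q : q \in std_quads r -> triangles (blk o q) =
    [set t in map (fun t => [set i in map o t]) (quad_triangles q)].
  case: q => [[[a b] c] d] /(allP ok) /andP[Uq q10].
  rewrite /blk triangles_k4e; last by rewrite -(inord_uniq q10) in Uq.
  apply/setP => t; rewrite !inE; congr (_ || _); congr (_ == _); apply/setP => i;
    rewrite !inE orbA //.
have okq q t : q \in std_quads r -> t \in quad_triangles q ->
   exists a b c, [/\ t = [:: a; b; c], uniq t & all (gtn 10) t].
  case: q => [[[a b] c] d] /(allP ok) /andP[Uq /and5P[ha hb hc hd _]]; rewrite !inE =>
    /orP[] /eqP->.
    exists a, b, c; split; [by [] | | by apply/and4P].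
    by rewrite /= !inE !(uniq4_neq Uq).
  exists a, b, d; split; [by [] | | by apply/and4P].
  by rewrite /= !inE !(uniq4_neq Uq).
have tE t : t \in std_triangles r ->
   ([set o x; o y; o z] == [set i in map o t]) = sub3 [:: x; y; z] t.
  case/flatten_mapP=> q qr tq; have [a [b [c [-> Ut t10]]]] := okq q t qr tq.
  by rewrite -sub3E //; congr (_ == _); apply/setP => i; rewrite !inE orbA.
apply/bigcupP/hasP => [[B]|[t tr]].
  rewrite inE => /mapP[q qr ->]; rewrite (okT q qr) inE => /mapP[t tq /eqP E].
  have tr : t \in std_triangles r by apply/flatten_mapP; exists q.
  by exists t; rewrite // -tE.
rewrite -tE // => /eqP->; have /flatten_mapP[q qr tq] := tr.
exists (blk o q); first by rewrite inE map_f.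
by rewrite (okT q qr) inE; apply: (map_f (fun t => [set i in map o t])).
Qed.

Lemma scoreE tb l s t : score tb l s t =
  (s + \sum_(q <- l) (let: (a, b, c, d) := q in lookup tb a b c && lookup tb a b d),
   t + \sum_(q <- l) (let: (a, b, c, d) := q in lookup tb a b c + lookup tb a b d)).
Proof.
elim: l s t => [|[[[a b] c] d] l IH] s t /=; first by rewrite !big_nil !addn0.
rewrite !big_cons; case: (lookup tb a b c); case: (lookup tb a b d); rewrite /= !IH //=;
  by rewrite ?(addSn, addnS, add0n, addn0).
Qed.

Lemma score_cat tb l l' :
  score tb (l ++ l') 0 0 = pair_sum (score tb l 0 0) (score tb l' 0 0).
Proof. by rewrite !scoreE !big_cat /= !add0n. Qed.

(** A design has nine blocks, so a list of nine quads describing one has no repetition, and the two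
    sums over blocks become sums over [l]. *)
Lemma common_score r l : all quad_ok (std_quads r) -> all quad_ok l -> size l = 9 ->
  is_design (bset o (std_quads r)) -> is_design (bset o l) ->
  (#|bset o (std_quads r) :&: bset o l|,
   #|trianglesD (bset o (std_quads r)) :&: trianglesD (bset o l)|) =
  score (triangle_table (std_triangles r)) l 0 0.
Proof.
move=> okr okl l9 D1 D2; rewrite card_common_blocks // card_common_triangles // scoreE !add0n.
rewrite !sum_bset; try by rewrite card_design.
congr (_, _); apply: eq_big_seq => -[[[a b] c] d] ql;
  have /andP[U q10] := allP okl _ ql;
  have Uo : uniq (map o [:: a; b; c; d]) by rewrite inord_uniq.
all: have [E1 E2] := k4e_common_triangles (bset o (std_quads r)) Uo;
  rewrite /blk ?E1 ?E2; have /and5P[ha hb hc hd _] := q10;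
  rewrite !std_triangleP //; try (by apply/and4P);
  by rewrite /= !inE !(uniq4_neq U).
Qed.

Lemma mem_pairE u s : mem_pair u s = (u \in s).
Proof.
case: u => a b; rewrite -has_pred1 /mem_pair; apply: eq_has => -[c d] /=.
by rewrite !eqnE xpair_eqE (eq_sym c) (eq_sym d); case: (a == c).
Qed.

Lemma all_undup_pairs P s acc :
  all P (undup_pairs s acc) = all P s && all P acc.
Proof.
elim: s acc => [|u s IH] acc //=; case: ifP => [uacc|_]; rewrite IH /=; last first.
  by rewrite andbCA andbA.
case: (boolP (all P acc)) => [/allP Pacc|_]; last by rewrite !andbF.
by rewrite (Pacc u) // -mem_pairE.
Qed.

Lemma all_hubsP P a : all_hubs P -> sorted ltn a -> size a = 4 -> all (gtn 10) a -> P a.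
Proof.
case: a => [|i [|j [|k [|l []]]]] // H /and4P[ij jk kl _] _ /and5P[/= i10 j10 k10 l10 _].
have in_iota x y : x < y -> y < 10 -> y \in iota x.+1 (9 - x).
  by move=> xy y10; rewrite mem_iota xy /=; lia.
have {}H : all (fun j => all (fun k => all (fun l => P [:: i; j; k; l])
    (iota k.+1 (9 - k))) (iota j.+1 (9 - j))) (iota i.+1 (9 - i)).
  by apply: (allP H i); rewrite mem_iota.
by have := allP (allP (allP H j (in_iota _ _ ij j10)) k (in_iota _ _ jk k10)) l (in_iota _
  _ kl l10).
Qed.

Lemma spectrum_checkP tb a s t : spectrum_check tb a -> s \in splits -> t \in splits0 ->
  score tb (design_quads a (subrest a s) (subrest a t)) 0 0 \in spectrum.
Proof.
rewrite /spectrum_check /design_quads score_cat -mem_pairE.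
(* The concrete lists are abstracted so that unification does not unfold them. *)
move: splits splits0 spectrum => sp sp0 spec.
rewrite all_undup_pairs andbT => /allP H sin tin.
have := H _ (map_f (fun s => score tb (hub_quads a (subrest a s)) 0 0) sin).
rewrite all_undup_pairs andbT => /allP; apply.
exact: (map_f (fun s => score tb (nonhub_quads (subrest a s)) 0 0)).
Qed.

Lemma spectrum_score r a s t : r \in reps ->
  sorted ltn a -> size a = 4 -> all (gtn 10) a -> s \in splits -> t \in splits0 ->
  score (triangle_table (std_triangles r)) (design_quads a (subrest a s) (subrest a t)) 0 0
    \in spectrum.
Proof.
move=> rin asort a4 a10; apply: spectrum_checkP.
by apply: (@all_hubsP (spectrum_check _)) => //; apply: (allP spectrum_checked).
Qed.

(** * Realization of the forty values *)

Definition quad_edge (q : quad nat) (x y : nat) :=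
  let: (a, b, c, d) := q in
  [&& natmem x [:: a; b; c; d], natmem y [:: a; b; c; d] &
      natmem x [:: a; b] || natmem y [:: a; b]].

Definition design_check (l : seq (quad nat)) :=
  all quad_ok l &&
  all (fun x => all (fun y => eqn x y || eqn (count (fun q => quad_edge q x y) l) 1)
    (iota 0 10)) (iota 0 10).

Lemma mem_blk q (x y : 'I_10) : quad_ok q -> x != y ->
  ([set x; y] \in blk o q) = quad_edge q x y.
Proof.
case: q => [[[a b] c] d] /andP[U q10] nxy; rewrite /blk.
rewrite mem_k4e ?nxy; last by rewrite -(inord_uniq q10) in U.
have memo s (z : 'I_10) : all (gtn 10) s -> (z \in map o s) = natmem z s.
  move=> /allP s10; rewrite natmemE; apply/mapP/idP => [[u us ->]|zs].
    by rewrite inordK //; apply: s10.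
  by exists (z : nat); rewrite ?inord_val.
have /and5P[ha hb _ _ _] := q10; have ab10 : all (gtn 10) [:: a; b] by apply/and3P.
rewrite -[[:: o a; o b; o c; o d]]/(map o [:: a; b; c; d]) -[[:: o a; o b]]/(map o [:: a; b]).
by rewrite !memo.
Qed.

Lemma design_checkP l : design_check l -> is_design (bset o l).
Proof.
case/andP=> /allP ok /allP cover; split=> [B|x y nxy].
  rewrite in_set => /mapP[[[[a b] c] d] ql ->]; have /andP[U q10] := ok _ ql.
  by exists (o a), (o b), (o c), (o d); split=> //; rewrite -(inord_uniq q10) in U.
have /allP/(_ y) := cover x ltac:(by rewrite mem_iota ltn_ord).
rewrite mem_iota ltn_ord => /(_ isT); rewrite !eqnE val_eqE (negPf nxy) /=.
rewrite -size_filter => /eqP F1; apply/eqP/cards1P.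
have memF q : q \in filter (fun q => quad_edge q x y) l = (q \in l) && ([set x;
  y] \in blk o q).
  by rewrite mem_filter andbC; apply: andb_id2l => ql; rewrite mem_blk //; apply: ok.
case: (filter _ _) F1 memF => [|p []] // _ memF; exists (blk o p).
apply/setP => B; rewrite in_set1 !in_set; apply/andP/eqP => [[/mapP[q ql ->] qB]|->].
  by have := memF q; rewrite ql qB mem_seq1 /= => /eqP->.
by have := memF p; rewrite mem_seq1 eqxx => /esym/andP[pl ->]; rewrite map_f.
Qed.

Lemma reps_checked : all (fun r => design_check (std_quads r)) reps.
Proof. by vm_compute. Qed.

(** One entry per element of [spectrum], in the same order: the index of the first design in [reps],
    then the hubs, the partition and the cycle of the second design. *)
Definition witnesses : seq (nat * seq nat * seq nat * seq nat) :=
  [:: (0, [:: 0; 1; 2; 3], [:: 6; 7; 8; 9; 4; 5], [:: 4; 5; 8; 9; 6; 7]);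
      (0, [:: 0; 1; 2; 4], [:: 3; 6; 8; 9; 5; 7], [:: 3; 5; 8; 9; 6; 7]);
      (0, [:: 0; 1; 2; 3], [:: 4; 6; 8; 9; 5; 7], [:: 4; 5; 8; 9; 6; 7]);
      (0, [:: 0; 1; 2; 3], [:: 6; 7; 8; 9; 4; 5], [:: 4; 6; 5; 8; 7; 9]);
      (0, [:: 0; 1; 2; 3], [:: 4; 6; 5; 8; 7; 9], [:: 4; 5; 8; 9; 6; 7]);
      (0, [:: 0; 1; 2; 3], [:: 4; 6; 8; 9; 5; 7], [:: 4; 6; 5; 8; 7; 9]);
      (0, [:: 0; 1; 2; 3], [:: 4; 6; 5; 8; 7; 9], [:: 4; 5; 6; 8; 7; 9]);
      (0, [:: 0; 1; 2; 3], [:: 4; 6; 5; 8; 7; 9], [:: 4; 6; 5; 8; 7; 9]);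
      (0, [:: 0; 1; 2; 3], [:: 4; 6; 7; 8; 5; 9], [:: 4; 5; 6; 8; 7; 9]);
      (0, [:: 0; 1; 2; 3], [:: 4; 6; 7; 8; 5; 9], [:: 4; 6; 5; 8; 7; 9]);
      (0, [:: 0; 1; 2; 4], [:: 6; 7; 3; 5; 8; 9], [:: 3; 5; 8; 9; 6; 7]);
      (0, [:: 0; 1; 2; 4], [:: 6; 7; 3; 5; 8; 9], [:: 3; 5; 6; 8; 7; 9]);
      (0, [:: 0; 1; 2; 4], [:: 3; 6; 5; 7; 8; 9], [:: 3; 5; 8; 9; 6; 7]);
      (0, [:: 0; 1; 2; 4], [:: 3; 5; 8; 9; 6; 7], [:: 3; 5; 6; 7; 8; 9]);
      (0, [:: 0; 1; 2; 4], [:: 3; 6; 5; 7; 8; 9], [:: 3; 6; 5; 8; 7; 9]);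
      (0, [:: 0; 1; 2; 4], [:: 3; 5; 6; 8; 7; 9], [:: 3; 5; 6; 7; 8; 9]);
      (0, [:: 0; 1; 6; 8], [:: 4; 5; 2; 7; 3; 9], [:: 2; 3; 4; 7; 5; 9]);
      (0, [:: 0; 1; 6; 8], [:: 4; 7; 2; 5; 3; 9], [:: 2; 3; 4; 5; 7; 9]);
      (0, [:: 0; 1; 2; 3], [:: 4; 5; 8; 9; 6; 7], [:: 4; 5; 8; 9; 6; 7]);
      (0, [:: 0; 1; 2; 4], [:: 6; 7; 3; 5; 8; 9], [:: 3; 5; 6; 7; 8; 9]);
      (0, [:: 0; 1; 2; 3], [:: 4; 5; 8; 9; 6; 7], [:: 4; 5; 6; 8; 7; 9]);
      (0, [:: 0; 1; 2; 3], [:: 4; 5; 8; 9; 6; 7], [:: 4; 6; 5; 8; 7; 9]);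
      (0, [:: 0; 1; 2; 3], [:: 4; 5; 6; 8; 7; 9], [:: 4; 5; 8; 9; 6; 7]);
      (0, [:: 0; 1; 6; 8], [:: 4; 5; 2; 7; 3; 9], [:: 2; 3; 4; 5; 7; 9]);
      (0, [:: 0; 1; 2; 3], [:: 4; 5; 6; 8; 7; 9], [:: 4; 5; 6; 8; 7; 9]);
      (0, [:: 0; 1; 2; 3], [:: 4; 5; 6; 8; 7; 9], [:: 4; 6; 5; 8; 7; 9]);
      (0, [:: 0; 1; 2; 3], [:: 6; 7; 8; 9; 4; 5], [:: 4; 5; 6; 7; 8; 9]);
      (0, [:: 0; 1; 2; 3], [:: 4; 6; 8; 9; 5; 7], [:: 4; 5; 6; 7; 8; 9]);
      (0, [:: 0; 1; 2; 4], [:: 3; 5; 6; 7; 8; 9], [:: 3; 5; 6; 7; 8; 9]);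
      (0, [:: 0; 1; 2; 3], [:: 4; 6; 5; 8; 7; 9], [:: 4; 5; 6; 7; 8; 9]);
      (0, [:: 0; 1; 2; 3], [:: 4; 6; 7; 8; 5; 9], [:: 4; 5; 6; 7; 8; 9]);
      (1, [:: 0; 1; 8; 9], [:: 4; 5; 3; 6; 2; 7], [:: 2; 3; 4; 5; 6; 7]);
      (0, [:: 0; 1; 8; 9], [:: 4; 5; 2; 3; 6; 7], [:: 2; 3; 4; 5; 6; 7]);
      (1, [:: 0; 1; 8; 9], [:: 4; 5; 2; 6; 3; 7], [:: 2; 3; 4; 5; 6; 7]);
      (0, [:: 0; 1; 2; 3], [:: 4; 5; 8; 9; 6; 7], [:: 4; 5; 6; 7; 8; 9]);
      (0, [:: 0; 1; 2; 3], [:: 4; 5; 6; 8; 7; 9], [:: 4; 5; 6; 7; 8; 9]);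
      (0, [:: 0; 1; 2; 3], [:: 4; 5; 6; 7; 8; 9], [:: 4; 5; 8; 9; 6; 7]);
      (0, [:: 0; 1; 2; 3], [:: 4; 5; 6; 7; 8; 9], [:: 4; 5; 6; 8; 7; 9]);
      (0, [:: 0; 1; 2; 3], [:: 4; 5; 6; 7; 8; 9], [:: 4; 6; 5; 8; 7; 9]);
      (0, [:: 0; 1; 2; 3], [:: 4; 5; 6; 7; 8; 9], [:: 4; 5; 6; 7; 8; 9])].

Definition witness_score (w : nat * seq nat * seq nat * seq nat) :=
  let: (k, a, n, m) := w in
  score (triangle_table (std_triangles (nth [::] reps k))) (design_quads a n m) 0 0.

Lemma witnesses_checked :
  all (fun w => let: (k, a, n, m) := w in
    (k < 3) && (size (design_quads a n m) == 9) && design_check (design_quads a n m))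
      witnesses.
Proof. by vm_compute. Qed.

Lemma witness_scores : map witness_score witnesses = spectrum.
Proof. by vm_compute. Qed.

Lemma rep_design r : r \in reps -> is_design (bset o (std_quads r)) /\ all quad_ok
  (std_quads r).
Proof. by move=> /(allP reps_checked) ok; split; [apply: design_checkP | case/andP: ok]. Qed.

Lemma spectrum_realized s t : (s, t) \in spectrum ->
  exists B1 B2 : {set {set {set 'I_10}}}, [/\ is_design B1, is_design B2,
    #|B1 :&: B2| = s & #|trianglesD B1 :&: trianglesD B2| = t].
Proof.
rewrite -witness_scores => /mapP[[[[k a] n] m] win E].
have /andP[/andP[k3 /eqP l9] ok] := allP witnesses_checked _ win.
have rin : nth [::] reps k \in reps by apply: mem_nth.
have [D1 ok1] := rep_design rin; have D2 := design_checkP ok.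
exists (bset o (std_quads (nth [::] reps k))), (bset o (design_quads a n m)).
have /andP[okl _] := ok.
by have := common_score ok1 okl l9 D1 D2; rewrite -[RHS]/(witness_score (k, a, n, m)) -E =>
  -[-> ->].
Qed.

(** * Normal form of a design up to relabelling *)

Definition map_quad (T T' : Type) (f : T -> T') (q : quad T) : quad T' :=
  let: (a, b, c, d) := q in (f a, f b, f c, f d).

Lemma blk_map T T' v (f : T' -> 'I_v) (g : T -> T') q : blk f (map_quad g q) = blk (f \o g) q.
Proof. by case: q => [[[a b] c] d]. Qed.

Lemma bset_map T T' v (f : T' -> 'I_v) (g : T -> T') l :
  bset f (map (map_quad g) l) = bset (f \o g) l.
Proof.
apply/setP => B; rewrite !in_set -map_comp; congr (_ \in _); apply: eq_map => q.
exact: blk_map.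
Qed.

Lemma size6 (T : Type) (s : seq T) : size s = 6 ->
  exists x0 x1 x2 x3 x4 x5, s = [:: x0; x1; x2; x3; x4; x5].
Proof.
case: s => [|x0 [|x1 [|x2 [|x3 [|x4 [|x5 []]]]]]] // _.
by exists x0, x1, x2, x3, x4, x5.
Qed.

Lemma size4 (T : Type) (s : seq T) : size s = 4 ->
  exists x0 x1 x2 x3, s = [:: x0; x1; x2; x3].
Proof. by case: s => [|x0 [|x1 [|x2 [|x3 []]]]] // _; exists x0, x1, x2, x3. Qed.

Lemma splits_size s : s \in splits -> size s = 6.
Proof. by rewrite splitsE mem_filter mem_permutations => /andP[_ /perm_size->]. Qed.

Lemma splits0_sub t : t \in splits0 -> t \in splits.
Proof. by rewrite splits0E mem_filter => /andP[]. Qed.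

Lemma design_quads_map T (a n m : seq nat) (h : nat -> T) :
  size a = 4 -> size n = 6 -> size m = 6 ->
  hub_quads (map h a) (map h n) ++ nonhub_quads (map h m) =
  map (map_quad h) (design_quads a n m).
Proof.
move=> /size4[? [? [? [? ->]]]] /size6[? [? [? [? [? [? ->]]]]]].
by move=> /size6[? [? [? [? [? [? ->]]]]]].
Qed.

(** With the four hubs in front, the label 4 + i denotes the point at position i among the
    others. *)
Lemma nth_cat4 a s (R : seq nat) : size a = 4 ->
  map (nth 0 (a ++ R)) (map (addn 4) s) = map (nth 0 R) s.
Proof.
move=> a4; rewrite -map_comp; apply: eq_map => x /=.
by rewrite nth_cat a4 ltnNge leq_addr /= addKn.
Qed.

Lemma perm_rest a : uniq a -> all (gtn 10) a -> perm_eq (a ++ rest a) (iota 0 10).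
Proof.
move=> Ua /allP a10; apply: uniq_perm; last 1 first.
- move=> x; rewrite mem_cat mem_filter natmemE mem_iota /=.
  by case: (boolP (x \in a)) => [/a10|].
- rewrite cat_uniq Ua filter_uniq ?iota_uniq // andbT.
  by apply/hasPn => x; rewrite mem_filter natmemE => /andP[].
- exact: iota_uniq.
Qed.

Lemma sub_quads_bset v (f : nat -> 'I_v) l l' :
  sub_quads l l' -> bset f l \subset bset f l'.
Proof.
move=> /allP sub; apply/subsetP => B; rewrite !in_set => /mapP[p /sub/hasP[q ql pq] ->].
suff -> : blk f p = blk f q by apply: map_f.
case: p q pq {ql} => [[[a b] c] d] [[[a' b'] c'] d'] /andP[].
rewrite /same_pair !eqnE /blk => /orP[] /andP[/eqP-> /eqP->] /orP[] /andP[/eqP-> /eqP->] //.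
- by rewrite k4eCr.
- by rewrite k4eCl.
- by rewrite k4eCl k4eCr.
Qed.

Lemma relabel_bset v (f : 'I_v -> 'I_v) (g : nat -> 'I_v) l :
  relabel f @: bset g l = bset (f \o g) l.
Proof.
have relB q : relabel f (blk g q) = blk (f \o g) q.
  by case: q => [[[a b] c] d]; rewrite /blk relabel_k4e.
apply/setP => B; rewrite in_set; apply/imsetP/mapP => [[C]|[q ql ->]].
  by rewrite in_set => /mapP[q ql ->] ->; exists q; rewrite ?relB.
rewrite -relB; by exists (blk g q); rewrite ?in_set ?map_f.
Qed.

Lemma eq_bset v (f g : nat -> 'I_v) l :
  all quad_ok l -> (forall i, i < 10 -> f i = g i) -> bset f l = bset g l.
Proof.
move=> /allP ok fg; apply/setP => B; rewrite !in_set; congr (_ \in _).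
apply/eq_in_map => -[[[a b] c] d] /ok /andP[_ /and5P[/= ? ? ? ? _]].
by rewrite /blk !fg.
Qed.

Lemma nonhub_autos_size : all (fun u => size u == 6) nonhub_autos.
Proof. by vm_compute. Qed.

Lemma hub_perms_size : all (fun u => size u == 4) hub_perms.
Proof. by vm_compute. Qed.

Lemma reps_size : all (fun r => size r == 6) reps.
Proof. by vm_compute. Qed.

Lemma design_normal_form Bs : is_design Bs ->
  exists f : 'I_10 -> 'I_10, exists2 r, r \in reps &
    injective f /\ Bs = relabel f @: bset o (std_quads r).
Proof.
move=> D; have [a [s [t [[asort a4 a10] sin tin EBs]]]] := design_shape D.
have Ua : uniq a by apply: sorted_uniq asort => [? ? ?|?]; [exact: ltn_trans|exact: ltnn].
have s6 := splits_size sin; have t6 := splits_size (splits0_sub tin).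
have /hasP[r rin /hasP[u uin]] := allP (allP normal_checked s sin) t tin.
cbv beta zeta; set m := [seq 4 + nth 0 t i | i <- u]; case: ifP =>
  // _ /hasP[p pin /and3P[Upm pm10 sub]].
have u6 := eqP (allP nonhub_autos_size u uin).
have p4 := eqP (allP hub_perms_size p pin); have r6 := eqP (allP reps_size r rin).
have m6 : size m = 6 by rewrite size_map.
(* [g] is the relabelling found by [normal_check], from the representative to a design with hubs 0,
   ..., 3; [h] then moves these labels to the actual hubs and non-hubs. *)
pose h := nth 0 (a ++ rest a); pose g := nth 0 (p ++ m).
have Ph := perm_rest Ua a10.
have h10 x : x < 10 -> h x < 10.
  have := perm_mem Ph (h x); rewrite mem_iota /= add0n => <- x10.
  by rewrite mem_nth // (perm_size Ph) size_iota.
have g10 x : x < 10 -> g x < 10.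
  by move=> x10; apply: (allP pm10); rewrite mem_nth // size_cat p4 m6.
pose f (i : 'I_10) : 'I_10 := o (h (g i)).
have f_inj : injective f.
  move=> i j /(congr1 val); rewrite /= !inordK ?h10 ?g10 // => /eqP.
  rewrite nth_uniq ?(perm_size Ph) ?size_iota ?g10 ?(perm_uniq Ph) ?iota_uniq //.
  by rewrite nth_uniq ?size_cat ?p4 ?m6 // => /eqP/val_inj.
exists f, r => //; split=> //.
have quadsE : design_quads a (subrest a s) (subrest a t) =
    map (map_quad h) (design_quads (iota 0 4) (map (addn 4) s) (map (addn 4) t)).
  rewrite -design_quads_map ?size_map ?s6 ?t6 // /h !nth_cat4 //.
  by case/size4: (a4) => [? [? [? [? ->]]]].
have stdE : design_quads p (map g r) m = map (map_quad g) (std_quads r).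
  rewrite -design_quads_map // /g.
  by case/size4: p4 => [? [? [? [? ->]]]]; case/size6: m6 => [? [? [? [? [? [? ->]]]]]].
have [D1 ok1] := rep_design rin.
have fE : bset (f \o o) (std_quads r) = bset (o \o h) (design_quads p (map g r) m).
  by rewrite stdE bset_map; apply: eq_bset => // i i10; rewrite /f /= inordK.
(* Both sides have nine blocks, so the inclusion given by [sub_quads] is enough. *)
apply/eqP; rewrite eqEcard; apply/andP; split; last first.
  by rewrite (card_imset _ (relabel_inj f_inj)) (card_design D) (card_design D1).
rewrite EBs quadsE bset_map relabel_bset fE.
exact: sub_quads_bset.
Qed.

(** * Completeness of the list of values, and the theorem *)

Lemma shape_quads_ok a n m : size a = 4 -> size n = 6 -> size m = 6 ->
  all (gtn 10) a -> all (gtn 10) n -> all (gtn 10) m ->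
  is_design (bset o (design_quads a n m)) ->
  all quad_ok (design_quads a n m) && (size (design_quads a n m) == 9).
Proof.
move=> a4 n6 m6 a10 n10 m10 D.
have lt10 : all (fun q => let: (a, b, c, d) := q in all (gtn 10) [:: a; b; c;
  d]) (design_quads a n m).
  case/size4: a4 a10 => [? [? [? [? ->]]]] /and5P[/= a0 a1 a2 a3 _].
  case/size6: n6 n10 => [? [? [? [? [? [? ->]]]]]] /and5P[/= n0 n1 n2 n3 /and3P[/= n4 n5 _]].
  case/size6: m6 m10 => [? [? [? [? [? [? ->]]]]]] /and5P[/= m0 m1 m2 m3 /and3P[/= m4 m5 _]].
  by rewrite /= !(a0, a1, a2, a3, n0, n1, n2, n3, n4, n5, m0, m1, m2, m3, m4, m5).
apply/andP; split.
  apply/allP => -[[[x y] z] w] ql; have q10 := allP lt10 _ ql.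
  rewrite /quad_ok q10 andbT -(inord_uniq q10); apply: k4e_uniq.
  by apply: D.1; rewrite in_set; apply: (map_f (blk o) ql).
case/size4: a4 => [? [? [? [? ->]]]]; case/size6: n6 => [? [? [? [? [? [? ->]]]]]].
by case/size6: m6 => [? [? [? [? [? [? ->]]]]]].
Qed.

Lemma relabelK v (f g : 'I_v -> 'I_v) : cancel g f -> cancel (relabel g) (relabel f).
Proof.
move=> gf B; rewrite /relabel -imset_comp -[RHS]imset_id; apply: eq_imset => e /=.
by rewrite -imset_comp -[RHS]imset_id; apply: eq_imset => x /=.
Qed.

(** Undoing [f] on both designs makes the first a representative and preserves both numbers; the
    second is still arbitrary, and [design_shape] places it within the enumeration. *)
Lemma spectrum_complete (B1 B2 : {set {set {set 'I_10}}}) :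
  is_design B1 -> is_design B2 ->
  (#|B1 :&: B2|, #|trianglesD B1 :&: trianglesD B2|) \in spectrum.
Proof.
move=> D1 D2; have [f [r rin [f_inj E1]]] := design_normal_form D1.
have [g fg gf] : bijective f by apply: injF_bij.
have g_inj : injective g := can_inj gf.
have E2 : B2 = relabel f @: (relabel g @: B2).
  by rewrite -imset_comp -[LHS]imset_id; apply: eq_imset => B /=; rewrite relabelK.
have D2' := relabel_design g_inj D2; have [Dr okr] := rep_design rin.
rewrite {}E1 {}E2 relabel_common_blocks // relabel_common_triangles //.
have [a [s [t [[asort a4 a10] sin tin E]]]] := design_shape D2'.
have s6 := splits_size sin; have t6 := splits_size (splits0_sub tin).
have rest10 u : all (gtn 10) (subrest a u).
  (* A position past the end of [rest a] gives the default 0, which is below 10 too. *)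
  apply/allP => _ /mapP[x _ ->]; case: (ltnP x (size (rest a))) => [lt|ge]; last first.
    by rewrite nth_default.
  by have := mem_nth 0 lt; rewrite mem_filter mem_iota => /and3P[].
rewrite E in D2' *.
have /andP[ok /eqP l9] : all quad_ok (design_quads a (subrest a s) (subrest a t)) &&
    (size (design_quads a (subrest a s) (subrest a t)) == 9).
  by apply: shape_quads_ok; rewrite ?size_map.
by rewrite common_score //; apply: spectrum_score.
Qed.

Lemma FinE s t : Fin 10 s t <-> (s, t + 2 * s) \in spectrum.
Proof.
split=> [[B1 [B2 [D1 D2 <- <-]]]|/spectrum_realized[B1 [B2 [D1 D2 Es Et]]]].
  exact: spectrum_complete.
by exists B1, B2.
Qed.

Definition exceptions := [:: (1, 8); (3, 1); (3, 5); (4, 1); (4, 3); (5, 1); (5, 2)].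

(** For [p] equal to [(s, t + 2 * s)] the inequality amounts to s + t <= 9, and the truncated
    difference recovers t. *)
Lemma spectrum_bounds :
  all (fun p => (p.2 <= 9 + p.1) && ((p.1, p.2 - 2 * p.1) \notin exceptions)) spectrum.
Proof. by vm_compute. Qed.

Lemma spectrum_admissible :
  all (fun s => all (fun t =>
    [&& s + t <= 9, s \in map fst spectrum, t + 2 * s \in map snd spectrum &
        (s, t) \notin exceptions] ==> ((s, t + 2 * s) \in spectrum))
    (iota 0 10)) (iota 0 10).
Proof. by vm_compute. Qed.

Theorem theorem4p4 : forall s t : nat,
  Fin 10 s t <->
  (Adm 10 s t /\
   (s, t) \notin [:: (1, 8); (3, 1); (3, 5); (4, 1); (4, 3); (5, 1); (5, 2)]).
Proof.
move=> s t; split=> [F|[[st [A1 [A2 [DA1 DA2 Es]]] [C1 [C2 [DC1 DC2 Et]]]] nst]].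
  have /(allP spectrum_bounds)/andP[/= bound] := (FinE s t).1 F; rewrite addnK => nst.
  split=> //; case: F => [B1 [B2 [D1 D2 Es Et]]].
  by split; [move: bound; rewrite /bv -[10 * _ %/ 10]/9; lia | exists B1, B2 | exists B1, B2].
apply/FinE.
(* Admissibility provides s and t + 2s from possibly different pairs of designs, so each is located
   only in its own projection of [spectrum]. *)
have s_in : s \in map fst spectrum by rewrite -Es; apply: map_f (spectrum_complete DA1 DA2).
have t_in : t + 2 * s \in map snd spectrum by rewrite -Et; apply:
  map_f (spectrum_complete DC1 DC2).
have {}st : s + t <= 9 by [].
have si : s \in iota 0 10 by rewrite mem_iota; lia.
have ti : t \in iota 0 10 by rewrite mem_iota; lia.
by have := allP (allP spectrum_admissible s si) t ti; rewrite st s_in t_in nst.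
Qed.
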